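(* Let $n=2^q$ with $q$ an integer, let $U=(U_k)_{k=0,\ldots,n-1}$ be $m\times m$ real matrices such that $\mathcal{T}(U)$ is a subgenerator, and let $\epsilon\in\mathbb{C}$ with $0<|\epsilon|<1$. Let $Y=(Y_k)_{k=0,\ldots,n-1}$ be such that $\mathcal{C}_\epsilon(Y)=e^{\mathcal{C}_\epsilon(U)}$, let $\widehat Y_k$ be the value of $Y_k$ provided by Algorithm A (described in the context) applied in floating point arithmetic with precision $\mu$, and set $\Delta_{Y_k}=Y_k-\widehat Y_k$. Then, for $k=0,\ldots,n-1$, $$\|\Delta_{Y_k}\|_\infty\ \dot\le\ \mu\,|\epsilon|^{-1}\,m\,\varphi,$$ where $$\varphi= m n(\zeta+\gamma \log_2 n)\max_{r,s,h}|(U_h)_{r,s}|+(\zeta+\gamma\sqrt n\,\log_2 n)\max_h\|Y_h\|_\infty+\tau,$$ $\zeta\doteq 1+2\sqrt2$, $\gamma\doteq 4\sqrt2+1$, and $\tau$ is a constant such that $\tau\mu$ bounds the error in the computation of the matrix exponential, i.e. $\|\mathrm{fl}(e^V)-e^V\|_\infty\le\mu\tau\|e^V\|_\infty$ for an $m\times m$ matrix $V$.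
   Context: Matrices. For a block-vector $U=(U_i)_{i=0,\ldots,n-1}$ of $m\times m$ matrices, $\mathcal{T}(U)$ is the $n\times n$ block upper triangular block-Toeplitz matrix with $(i,j)$ block $U_{j-i}$ if $j\ge i$ and $0$ otherwise. The block-$\epsilon$-circulant matrix $\mathcal{C}_\epsilon(U)$ has $(i,j)$ block $U_{j-i}$ if $j\ge i$ and $\epsilon U_{n+j-i}$ if $j<i$. The exponential of a block-$\epsilon$-circulant matrix is again block-$\epsilon$-circulant. A subgenerator is a real square matrix with nonnegative off-diagonal entries, negative diagonal entries and nonpositive row sums. $\|\cdot\|_\infty$ is the induced infinity norm. Algorithm A (exponential of a block-$\epsilon$-circulant matrix). Let $\theta=\epsilon^{1/n}$ be an $n$-th root of $\epsilon$ and $\omega_n=\cos\frac{2\pi}{n}+\mathtt{i}\sin\frac{2\pi}{n}$, and let $F=(\omega_n^{ij})_{i,j=0,\ldots,n-1}$ be the Fourier matrix, with conjugate transpose $F^H$. (1) $Z_k=\theta^kU_k$, $k=0,\ldots,n-1$. (2) $V_k=\sum_{j}\overline{\omega_n}^{\,kj}Z_j$, i.e. for each entry position $(r,s)$ the vector $((V_k)_{r,s})_k$ is $F^H$ times $((Z_k)_{r,s})_k$, computed by FFT. (3) $W_k=e^{V_k}$, $k=0,\ldots,n-1$. (4) $R_k=\frac1n\sum_j\omega_n^{kj}W_j$, computed entrywise by FFT. (5) $Y_k=\theta^{-k}R_k$. In exact arithmetic the output satisfies $\mathcal{C}_\epsilon(Y)=e^{\mathcal{C}_\epsilon(U)}$.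 Floating point model. $\mathrm{fl}(\cdot)$ denotes the computed value and $\mu$ the machine precision. - For $x,y\in\mathbb{C}$, $\mathrm{fl}(xy)=xy(1+\eta)$ with $|\eta|\le\frac{2\sqrt2}{1-2\mu}\mu$. - The constants $\theta^k$, $|k|\le n-1$, are precomputed and replaced by $\theta^k(1+\sigma_k)$ with $|\sigma_k|\le\mu$. - FFTs are computed by the Cooley–Tukey algorithm with roots of unity approximated up to error $\mu$. The computed value $\tilde y$ of $y=Fx$ (or $y=F^Hx$) satisfies $\|y-\tilde y\|_2\le \frac{q\eta}{1-q\eta}\|y\|_2$ with $\eta=\mu+(\sqrt2+\mu)\frac{4\mu}{1-4\mu}$, so that to first order $\|y-\tilde y\|_2\le\gamma\mu\log_2 n\,\|y\|_2$. Division by $n=2^q$ is taken to be exact. - $m\times m$ matrix exponentials are computed by an algorithm satisfying the stated error bound with constant $\tau$. The analysis is first order in $\mu$: $\doteq$ denotes equality, and $\dot\le$ inequality, up to lower order terms, i.e. up to terms of order higher than one in $\mu$ in error bounds (and, for the constants $\zeta,\gamma$, up to terms vanishing as $\mu\to0$), as $\mu\to0$ with the other data fixed. *)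

(* Defs.v *)
From HB Require Import structures.
From mathcomp Require Import all_boot all_order all_algebra complex.
From mathcomp Require Import all_classical all_reals all_analysis.
Set Implicit Arguments.
Unset Strict Implicit.
Unset Printing Implicit Defensive.
Import Order.TTheory GRing.Theory Num.Theory numFieldNormedType.Exports.
Local Open Scope classical_set_scope.
Local Open Scope ring_scope.
Local Open Scope complex_scope.

(* Normc.normc is the modulus on R[i], with values in R. *)

Section Norms.
Variable R : realType.

Definition vnorm_inf n (x : 'cV[R[i]]_n) : R :=
  \big[Num.max/0]_(i < n) Normc.normc (x i 0).

Definition vnorm2 n (x : 'cV[R[i]]_n) : R :=
  Num.sqrt (\sum_(i < n) Normc.normc (x i 0) ^+ 2).

(* The norm induced by vnorm_inf. *)
Definition mnorm_inf p n (A : 'M[R[i]]_(p, n)) : R :=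
  sup [set vnorm_inf (A *m x) | x in [set x : 'cV[R[i]]_n | vnorm_inf x <= 1]].

(* The limit is taken for the entrywise-max-norm topology of 'M[R[i]]_n. *)
Definition expmx n (A : 'M[R[i]]_n) : 'M[R[i]]_n :=
  limn (series (fun k : nat => (k`!%:R : R[i])^-1 *: A ^+ k)).

Definition log2 (x : R) : R := ln x / ln 2.

Definition subgenerator n (A : 'M[R]_n) : Prop :=
  [/\ forall i j, i != j -> 0 <= A i j,
      forall i, A i i < 0 &
      forall i, \sum_j A i j <= 0].

End Norms.

Section Blocks.
Variables (K : pzRingType) (n m : nat).

(* U_k for k < n; the value 0 for k >= n is never used below. *)
Definition blk (U : 'I_n -> 'M[K]_m) (k : nat) : 'M[K]_m :=
  oapp U 0 (insub k).

Definition block_toeplitz (U : 'I_n -> 'M[K]_m) : 'M[K]_(\sum_(i < n) m) :=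
  \mxblock_(i < n, j < n) (if (i <= j)%N then blk U (j - i) else 0).

Definition block_circulant (e : K) (U : 'I_n -> 'M[K]_m) :
    'M[K]_(\sum_(i < n) m) :=
  \mxblock_(i < n, j < n)
    (if (i <= j)%N then blk U (j - i) else e *: blk U (n + j - i)).

End Blocks.

Section AlgorithmA.
Variables (R : realType) (n m : nat).

Definition omega : R[i] := cos (2 * pi / n%:R) +i* sin (2 * pi / n%:R).

Definition fourier : 'M[R[i]]_n := \matrix_(i, j) omega ^+ (i * j).

Definition fourierH : 'M[R[i]]_n := (map_mx conjc fourier)^T.

(* The operations of a floating point arithmetic:
   fl_theta k is the stored approximation of theta ^ k, k : int;
   fl_mul x y is fl(xy);
   fl_F x and fl_FH x are the FFT values of fourier *m x and fourierH *m x;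
   fl_exp V is fl(e^V). *)
Record fl_arith := FlArith {
  fl_theta : int -> R[i];
  fl_mul : R[i] -> R[i] -> R[i];
  fl_F : 'cV[R[i]]_n -> 'cV[R[i]]_n;
  fl_FH : 'cV[R[i]]_n -> 'cV[R[i]]_n;
  fl_exp : 'M[R[i]]_m -> 'M[R[i]]_m }.

Definition fft_eta (mu : R) : R :=
  mu + (Num.sqrt 2 + mu) * (4 * mu / (1 - 4 * mu)).

(* q is the number of butterfly stages: n = 2 ^ q. *)
Definition fft_bound (q : nat) (mu : R) : R :=
  q%:R * fft_eta mu / (1 - q%:R * fft_eta mu).

Record fl_model (q : nat) (theta : R[i]) (tau mu : R) (fl : fl_arith) : Prop :=
  FlModel {
    fl_thetaP : forall k : int, (`|k| < n)%N ->
      exists2 sigma : R[i], Normc.normc sigma <= mu &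
        fl_theta fl k = theta ^ k * (1 + sigma);
    fl_mulP : forall x y : R[i],
      exists2 eta : R[i],
        Normc.normc eta <= 2 * Num.sqrt 2 / (1 - 2 * mu) * mu &
        fl_mul fl x y = x * y * (1 + eta);
    fl_FP : forall x : 'cV[R[i]]_n,
      vnorm2 (fourier *m x - fl_F fl x)
        <= fft_bound q mu * vnorm2 (fourier *m x);
    fl_FHP : forall x : 'cV[R[i]]_n,
      vnorm2 (fourierH *m x - fl_FH fl x)
        <= fft_bound q mu * vnorm2 (fourierH *m x);
    fl_expP : forall V : 'M[R[i]]_m,
      mnorm_inf (fl_exp fl V - expmx V) <= mu * tau * mnorm_inf (expmx V) }.

(* Exact division by n = 2 ^ q in the fourth step. *)
Definition algorithmA (fl : fl_arith) (U : 'I_n -> 'M[R[i]]_m) :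
    'I_n -> 'M[R[i]]_m :=
  let Z (k : 'I_n) : 'M[R[i]]_m :=
    \matrix_(r, s) fl_mul fl (fl_theta fl k%:Z) (U k r s) in
  let V (k : 'I_n) : 'M[R[i]]_m :=
    \matrix_(r, s) fl_FH fl (\col_j Z j r s) k 0 in
  let W (k : 'I_n) : 'M[R[i]]_m := fl_exp fl (V k) in
  let Rk (k : 'I_n) : 'M[R[i]]_m :=
    \matrix_(r, s) (fl_F fl (\col_j W j r s) k 0 / n%:R) in
  fun k => \matrix_(r, s) fl_mul fl (fl_theta fl (- k%:Z)) (Rk k r s).

End AlgorithmA.

(* Main.v *)
(* A block-eps-circulant matrix maps the block column (z^i I)_i, z^n = eps, to
   the same column times sum_h z^h U_h, so the blocks Y_h are recovered by a
   discrete Fourier transform from the exponentials of the m x m matrices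
   V = sum_h z^h U_h, |z| < 1.  The subgenerator property gives
   ||c I + V|| <= c for some c, hence ||e^V|| <= 1 and
   ||e^(V+D) - e^V|| <= e^||D|| - 1: the exponential step does not amplify
   errors to first order.  The two transforms are sqrt n times unitary, which
   turns the 2-norm bounds on the FFT errors into entrywise bounds, and the last
   scaling by theta^(-k) costs at most the factor |eps|^(-1). *)

Require Import Defs.
From mathcomp Require Import all_boot all_order all_algebra complex.
From mathcomp Require Import all_classical all_reals all_analysis.
From mathcomp Require Import ring lra.
Import Order.TTheory GRing.Theory Num.Theory numFieldNormedType.Exports.
Local Open Scope classical_set_scope.
Local Open Scope ring_scope.
Local Open Scope complex_scope.

Set Implicit Arguments.
Unset Strict Implicit.
Unset Printing Implicit Defensive.

(** Two layers are kept apart. For a fixed precision the error obeys an exact inequality whose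
    right-hand side depends only on [mu], the sizes, [tau], [maxU], [maxY] and the modulus of [eps];
    the expansion in [mu] is carried out on these scalar functions alone. Hence the constant [C] is
    chosen before the arithmetic [fl] and serves all arithmetics at once. The exponential is defined
    as a bare limit, so its convergence, the rule for scalar shifts and the perturbation bounds all
    come from partial sums, dominated by those of the real exponential series. A factor [m] is paid
    only where an entrywise bound on a transform becomes a row sum. The first-order coefficient
    obtained, before division by the modulus of [eps], is therefore [tau + m n (zeta + gamma q) maxU
    + (zeta + m gamma sqrt n q) maxY], which lies below [m phi]. *)

Local Notation nc := Normc.normc.

(** * Modulus of complex numbers and its comparison with real and imaginary parts *)

Section Modulus.
Variable R : realType.
Implicit Types x y z : R[i].

Lemma normc_ge0 z : 0 <= nc z.
Proof. by case: z => a b; exact: sqrtr_ge0. Qed.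

Lemma normcD x y : nc (x + y) <= nc x + nc y.
Proof. exact: le_normcD. Qed.

Lemma normc_sum (I : Type) (r : seq I) (P : pred I) (F : I -> R[i]) :
  nc (\sum_(i <- r | P i) F i) <= \sum_(i <- r | P i) nc (F i).
Proof.
elim/big_ind2 : _ => [|a b c d ab cd|//]; first by rewrite Normc.normc0.
by rewrite (le_trans (normcD _ _))// lerD.
Qed.

Lemma normc_real (a : R) : nc a%:C = `|a|.
Proof. by rewrite /Normc.normc /= expr0n addr0 sqrtr_sqr. Qed.

Lemma normc_conj z : nc z^* = nc z.
Proof. by case: z => a b; rewrite /Normc.normc /= sqrrN. Qed.

Lemma normcX z k : nc (z ^+ k) = nc z ^+ k.
Proof.
elim: k => [|k ih]; first by rewrite !expr0 Normc.normc1.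
by rewrite !exprS Normc.normcM ih.
Qed.

Lemma mulcJ z : z * z^* = (nc z ^+ 2)%:C.
Proof.
case: z => a b; rewrite /Normc.normc sqr_sqrtr ?addr_ge0 ?sqr_ge0//.
by apply/eqP; rewrite eq_complex /=; apply/andP; split; apply/eqP; ring.
Qed.

Lemma Re_le_normc z : `|complex.Re z| <= nc z.
Proof.
case: z => a b /=; rewrite -(sqrtr_sqr a) ler_sqrt ?addr_ge0 ?sqr_ge0//.
by rewrite lerDl sqr_ge0.
Qed.

Lemma Im_le_normc z : `|complex.Im z| <= nc z.
Proof.
case: z => a b /=; rewrite -(sqrtr_sqr b) ler_sqrt ?addr_ge0 ?sqr_ge0//.
by rewrite lerDr sqr_ge0.
Qed.

Lemma normc_le_ReIm z : nc z <= `|complex.Re z| + `|complex.Im z|.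
Proof.
case: z => a b /=; rewrite -[leRHS]ger0_norm ?addr_ge0// -sqrtr_sqr.
rewrite ler_sqrt ?sqr_ge0// sqrrD !real_normK ?num_real//.
by rewrite lerD2r lerDl mulrn_wge0// mulr_ge0.
Qed.

End Modulus.

(** * The induced infinity norm as a maximal row sum, and its submultiplicativity *)

Section InfinityNorm.
Variable R : realType.

Lemma vnorm_inf_ge n (x : 'cV[R[i]]_n) i : nc (x i 0) <= vnorm_inf x.
Proof. exact: (le_bigmax _ (fun i => nc (x i 0))). Qed.

Lemma vnorm_inf_le n (x : 'cV[R[i]]_n) b :
  0 <= b -> (forall i, nc (x i 0) <= b) -> vnorm_inf x <= b.
Proof. by move=> b0 xb; apply/bigmax_leP; split. Qed.

Lemma vnorm_inf_mul p n (A : 'M[R[i]]_(p, n)) (x : 'cV_n) b :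
  0 <= b -> (forall i, \sum_j nc (A i j) <= b) -> vnorm_inf x <= 1 ->
  vnorm_inf (A *m x) <= b.
Proof.
move=> b0 Ab x1; apply: vnorm_inf_le => // i; rewrite mxE.
apply: le_trans (Ab i); apply: le_trans (normc_sum _ _ _) _.
apply: ler_sum => j _; rewrite Normc.normcM ler_piMr ?normc_ge0//.
exact: le_trans (vnorm_inf_ge x j) x1.
Qed.

Definition phase (z : R[i]) : R[i] := if z == 0 then 0 else z^* / (nc z)%:C.

Lemma normc_eq0 (z : R[i]) : (nc z == 0) = (z == 0).
Proof.
by apply/eqP/eqP => [/Normc.eq0_normc//|->]; rewrite Normc.normc0.
Qed.

Lemma normc_phase z : nc (phase z) <= 1.
Proof.
rewrite /phase; case: ifPn => [_|z0]; first by rewrite Normc.normc0.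
rewrite Normc.normcM Normc.normcV normc_conj normc_real.
by rewrite (ger0_norm (normc_ge0 _)) divff// normc_eq0.
Qed.

Lemma mul_phase z : z * phase z = (nc z)%:C.
Proof.
rewrite /phase; case: ifPn => [/eqP->|z0]; first by rewrite mul0r Normc.normc0.
rewrite mulrA mulcJ -[X in _ / X]/(real_complex R _) -fmorphV -rmorphM /=.
by rewrite expr2 mulfK// normc_eq0.
Qed.

(** The supremum is reached row by row: the vector of conjugate phases of a row lies in the unit
    ball and turns each product in that row into a modulus. *)
Lemma mnorm_infE p n (A : 'M[R[i]]_(p, n)) :
  mnorm_inf A = \big[Num.max/0]_(i < p) \sum_j nc (A i j).
Proof.
set b := \big[_/_]_(i < p) _.
have b0 : 0 <= b by exact: bigmax_ge_id.
have Ab i : \sum_j nc (A i j) <= b.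
  exact: (le_bigmax _ (fun i => \sum_j nc (A i j))).
have ubb : ubound [set vnorm_inf (A *m x) |
                    x in [set x : 'cV[R[i]]_n | vnorm_inf x <= 1]] b.
  by move=> _ [x /= x1 <-]; exact: vnorm_inf_mul.
apply/eqP; rewrite eq_le; apply/andP; split.
  apply: ge_sup => //; exists (vnorm_inf (A *m 0)), 0 => //=.
  by apply: vnorm_inf_le => // i; rewrite mxE Normc.normc0.
apply/bigmax_leP; split=> [|i _].
  apply: (@le_trans _ _ (vnorm_inf (A *m 0))); first exact: bigmax_ge_id.
  apply: ub_le_sup; first by exists b.
  by exists 0 => //=; apply: vnorm_inf_le => // j; rewrite mxE Normc.normc0.
pose x : 'cV[R[i]]_n := \col_j phase (A i j).
apply: (@le_trans _ _ (vnorm_inf (A *m x))); last first.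
  apply: ub_le_sup; first by exists b.
  by exists x => //=; apply: vnorm_inf_le => // j; rewrite mxE normc_phase.
apply: le_trans (vnorm_inf_ge _ i); rewrite mxE.
under [in leRHS]eq_bigr do rewrite mxE mul_phase.
rewrite -[X in nc X](rmorph_sum (real_complex R)) normc_real.
exact: ler_norm.
Qed.

Lemma mnorm_inf_le p n (A : 'M[R[i]]_(p, n)) b :
  0 <= b -> (forall i, \sum_j nc (A i j) <= b) -> mnorm_inf A <= b.
Proof. by move=> b0 Ab; rewrite mnorm_infE; apply/bigmax_leP; split. Qed.

Lemma row_le_mnorm_inf p n (A : 'M[R[i]]_(p, n)) i :
  \sum_j nc (A i j) <= mnorm_inf A.
Proof.
by rewrite mnorm_infE; exact: (le_bigmax _ (fun i => \sum_j nc (A i j))).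
Qed.

Lemma mnorm_inf_ge0 p n (A : 'M[R[i]]_(p, n)) : 0 <= mnorm_inf A.
Proof. by rewrite mnorm_infE; exact: bigmax_ge_id. Qed.
Local Hint Resolve mnorm_inf_ge0 : core.

Lemma entry_le_mnorm_inf p n (A : 'M[R[i]]_(p, n)) i j :
  nc (A i j) <= mnorm_inf A.
Proof.
apply: le_trans (row_le_mnorm_inf A i); rewrite (bigD1 j)//= lerDl sumr_ge0//.
by move=> *; exact: normc_ge0.
Qed.

Lemma mnorm_inf_le_max p n (A : 'M[R[i]]_(p, n)) b :
  0 <= b -> (forall i j, nc (A i j) <= b) -> mnorm_inf A <= n%:R * b.
Proof.
move=> b0 Ab; apply: mnorm_inf_le => [|i]; first exact: mulr_ge0.
apply: le_trans (ler_sum _ (fun j _ => Ab i j)) _.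
by rewrite sumr_const card_ord mulr_natl.
Qed.

Lemma mnorm_infD p n (A B : 'M[R[i]]_(p, n)) :
  mnorm_inf (A + B) <= mnorm_inf A + mnorm_inf B.
Proof.
apply: mnorm_inf_le => [|i]; first exact: addr_ge0.
apply: le_trans (lerD (row_le_mnorm_inf A i) (row_le_mnorm_inf B i)).
by rewrite -big_split ler_sum// => j _; rewrite mxE normcD.
Qed.

Lemma mnorm_infZ p n (z : R[i]) (A : 'M[R[i]]_(p, n)) :
  mnorm_inf (z *: A) <= nc z * mnorm_inf A.
Proof.
apply: mnorm_inf_le => [|i]; first by rewrite mulr_ge0 ?normc_ge0.
under eq_bigr do rewrite mxE Normc.normcM.
by rewrite -mulr_sumr ler_wpM2l ?normc_ge0// row_le_mnorm_inf.
Qed.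

Lemma mnorm_inf0 p n : mnorm_inf (0 : 'M[R[i]]_(p, n)) = 0.
Proof.
apply/eqP; rewrite eq_le mnorm_inf_ge0 andbT mnorm_inf_le// => i.
by under eq_bigr do rewrite mxE Normc.normc0; rewrite big1.
Qed.

Lemma mnorm_inf0_eq0 p n (A : 'M[R[i]]_(p, n)) : mnorm_inf A = 0 -> A = 0.
Proof.
move=> A0; apply/matrixP => i j; rewrite mxE; apply: Normc.eq0_normc.
by apply/eqP; rewrite eq_le normc_ge0 andbT -A0 entry_le_mnorm_inf.
Qed.

Lemma mnorm_infN p n (A : 'M[R[i]]_(p, n)) : mnorm_inf (- A) = mnorm_inf A.
Proof.
rewrite !mnorm_infE; apply: eq_bigr => i _; apply: eq_bigr => j _.
by rewrite mxE -mulN1r Normc.normcM -[X in nc X]/(- 1%:C) normcN normc_real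
  normr1 mul1r.
Qed.

Lemma mnorm_infB p n (A B : 'M[R[i]]_(p, n)) :
  mnorm_inf (A - B) <= mnorm_inf A + mnorm_inf B.
Proof. by rewrite -[X in _ <= _ + X]mnorm_infN mnorm_infD. Qed.

Lemma mnorm_infBC p n (A B : 'M[R[i]]_(p, n)) :
  mnorm_inf (A - B) = mnorm_inf (B - A).
Proof. by rewrite -opprB mnorm_infN. Qed.

Lemma mnorm_inf_sum p n (I : Type) (r : seq I) (P : pred I)
    (F : I -> 'M[R[i]]_(p, n)) :
  mnorm_inf (\sum_(i <- r | P i) F i) <= \sum_(i <- r | P i) mnorm_inf (F i).
Proof.
elim/big_ind2 : _ => [|a b c d ab cd|//]; first by rewrite mnorm_inf0.
by rewrite (le_trans (mnorm_infD _ _))// lerD.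
Qed.

Lemma mnorm_infM p n l (A : 'M[R[i]]_(p, n)) (B : 'M[R[i]]_(n, l)) :
  mnorm_inf (A *m B) <= mnorm_inf A * mnorm_inf B.
Proof.
apply: mnorm_inf_le => [|i]; first exact: mulr_ge0.
apply: (@le_trans _ _ (\sum_k \sum_j nc (A i j) * nc (B j k))).
  apply: ler_sum => k _; rewrite mxE (le_trans (normc_sum _ _ _))//.
  by apply: ler_sum => j _; rewrite Normc.normcM.
rewrite exchange_big /=.
apply: le_trans (ler_wpM2r (mnorm_inf_ge0 B) (row_le_mnorm_inf A i)).
rewrite mulr_suml; apply: ler_sum => j _.
by rewrite -mulr_sumr ler_wpM2l ?normc_ge0// row_le_mnorm_inf.
Qed.

Lemma mnorm_inf1 n : mnorm_inf (1%:M : 'M[R[i]]_n) <= 1.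
Proof.
apply: mnorm_inf_le => // i; rewrite (bigD1 i)//= mxE eqxx big1 ?addr0.
  by rewrite Normc.normc1.
by move=> j ji; rewrite mxE eq_sym (negbTE ji) Normc.normc0.
Qed.

Lemma mnorm_infX n (A : 'M[R[i]]_n) k : mnorm_inf (A ^+ k) <= mnorm_inf A ^+ k.
Proof.
elim: k => [|k ih]; first by rewrite !expr0 mnorm_inf1.
by rewrite !exprS (le_trans (mnorm_infM _ _))// ler_wpM2l.
Qed.

End InfinityNorm.

(** * The matrix exponential: convergence, intertwining, scalar shifts, perturbation *)

Section MatrixExponential.
Variable R : realType.

Local Hint Resolve mnorm_inf_ge0 : core.

Definition expmx_sum n (A : 'M[R[i]]_n) : nat -> 'M[R[i]]_n :=
  series (fun k : nat => (k`!%:R : R[i])^-1 *: A ^+ k).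

Definition expR_sum (x : R) : nat -> R := series (exp_coeff x).

Lemma expR_sum_cvg (x : R) : expR_sum x @ \oo --> expR x.
Proof. exact: is_cvg_series_exp_coeff. Qed.

Lemma normc_natV k : nc ((k%:R : R[i])^-1) = k%:R^-1.
Proof. by rewrite Normc.normcV -(rmorph_nat (real_complex R)) normc_real
  normr_nat. Qed.

(* R[i] has no canonical topology of its own; the cast to numFieldType selects
   the one used by expmx. *)
Lemma matrix_cvg p n (u : nat -> 'M[R[i]]_(p, n)) (L : 'M[(R[i] :
  numFieldType)]_(p, n)) :
  (mnorm_inf (u N - L) @[N --> \oo] --> (0 : R)) -> u N @[N --> \oo] --> L.
Proof.
pose M : pseudoMetricType (R[i] : numFieldType) := 'M[(R[i] :
  numFieldType)]_(p, n).
move=> uL; apply: (proj2 (@cvg_ballP _ M _ _ _ (u : nat -> M) (L : M))) => e e0.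
have [e1 e2] : 0 < complex.Re e /\ e = (complex.Re e)%:C.
  move: e0; rewrite ltcE /= => /andP[/eqP i0 r0]; split => //.
  by case: e i0 {r0} => a b /= ->.
move/cvgr0Pnorm_lt : uL => /(_ _ e1) [N _ NuL]; exists N => // k /NuL /=.
rewrite ger0_norm; last exact: mnorm_inf_ge0.
move=> uke; split => // i j.
rewrite -ball_normE /= distrC e2.
rewrite -[X in X < _]/((nc (u k i j - L i j))%:C) ltcR.
apply: le_lt_trans uke; have := entry_le_mnorm_inf (u k - L) i j.
by rewrite !mxE.
Qed.

Lemma exp_term_le n (A : 'M[R[i]]_n) k :
  mnorm_inf ((k`!%:R : R[i])^-1 *: A ^+ k) <= exp_coeff (mnorm_inf A) k.
Proof.
rewrite (le_trans (mnorm_infZ _ _))// normc_natV exp_coeffE.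
by rewrite ler_wpM2l// ?mnorm_infX// invr_ge0 ler0n.
Qed.

Lemma cvg_sum (I : Type) (r : seq I) (f : I -> nat -> R) (l : I -> R) :
  (forall i, f i N @[N --> \oo] --> l i) ->
  (\sum_(i <- r) f i N) @[N --> \oo] --> \sum_(i <- r) l i.
Proof.
move=> fl; elim: r => [|i r ih].
  by rewrite big_nil; under eq_fun do rewrite big_nil; exact: cvg_cst.
by rewrite big_cons; under eq_fun do rewrite big_cons; exact: cvgD.
Qed.

(** Real and imaginary parts of each entry are real series dominated by the exponential series at
    [mnorm_inf A], so completeness is used over the reals only. The matrix [L] of their sums is then
    the limit by separation of the matrix topology. *)
Lemma expmx_cvg n (A : 'M[R[i]]_n) :
  mnorm_inf (expmx_sum A N - expmx A) @[N --> \oo] --> (0 : R).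
Proof.
pose a r s k := ((k`!%:R : R[i])^-1 *: A ^+ k) r s.
have a_le r s k : nc (a r s k) <= exp_coeff (mnorm_inf A) k.
  exact: le_trans (entry_le_mnorm_inf _ r s) (exp_term_le _ _).
have cvg_comp (f : R[i] -> R) r s : (forall z, `|f z| <= nc z) ->
    cvgn (series (f \o a r s)).
  move=> fz; apply: normed_cvg.
  apply: series_le_cvg (is_cvg_series_exp_coeff (mnorm_inf A)) => k //=.
    exact: exp_coeff_ge0.
  exact: le_trans (fz _) (a_le _ _ _).
have cRe r s := cvg_comp (@complex.Re R) r s (@Re_le_normc R).
have cIm r s := cvg_comp (@complex.Im R) r s (@Im_le_normc R).
pose L : 'M[R[i]]_n := \matrix_(r, s)
  (limn (series (@complex.Re R \o a r s)) +i*
   limn (series (@complex.Im R \o a r s))).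
suff SL : mnorm_inf (expmx_sum A N - L) @[N --> \oo] --> (0 : R).
  pose M : normedModType (R[i] : numFieldType) := 'M[(R[i] : numFieldType)]_n.
  have -> // : expmx A = L.
  apply: (@cvg_lim M (@norm_hausdorff _ M) nat \oo _ (expmx_sum A) L).
  exact: matrix_cvg.
have SLrs r s : nc ((expmx_sum A N - L) r s) @[N --> \oo] --> (0 : R).
  apply: (@squeeze_cvgr _ _ _ _ (fun=> 0)
    (fun N => `|series (@complex.Re R \o a r s) N -
                limn (series (@complex.Re R \o a r s))| +
              `|series (@complex.Im R \o a r s) N -
                limn (series (@complex.Im R \o a r s))|)).
  - near=> N; rewrite normc_ge0 /=.
    apply: le_trans (normc_le_ReIm _) _.
    rewrite !mxE /expmx_sum /series /= summxE !raddfB /= !raddf_sum /=.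
    by rewrite lexx.
  - exact: cvg_cst.
  - rewrite -[X in _ --> X]addr0; apply: cvgD.
    + apply/norm_cvg0P; rewrite -[X in _ --> X](subrr (limn (series
      (@complex.Re R \o a r s)))).
      by apply: cvgB; [exact: cRe|exact: cvg_cst].
    + apply/norm_cvg0P; rewrite -[X in _ --> X](subrr (limn (series
      (@complex.Im R \o a r s)))).
      by apply: cvgB; [exact: cIm|exact: cvg_cst].
apply: (@squeeze_cvgr _ _ _ _ (fun=> 0)
  (fun N => \sum_r \sum_s nc ((expmx_sum A N - L) r s))).
- near=> N; rewrite mnorm_inf_ge0 /= mnorm_inf_le//.
    by do 2 (apply: sumr_ge0 => ? _); exact: normc_ge0.
  move=> r; rewrite [leRHS](bigD1 r)//= lerDl.
  by do 2 (apply: sumr_ge0 => ? _); exact: normc_ge0.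
- exact: cvg_cst.
- rewrite [X in _ --> X](_ : 0 = \sum_(r < n) \sum_(s < n) (0 : R)); last first.
    by rewrite big1// => *; rewrite big1.
  apply: (@cvg_sum _ _ (fun r N => \sum_s nc ((expmx_sum A N - L) r s))
    (fun=> \sum_(s < n) 0)) => r.
  exact: (@cvg_sum _ _ (fun s N => nc ((expmx_sum A N - L) r s)) (fun=> 0)).
Unshelve. all: by end_near.
Qed.

(** The relation passes to powers and partial sums; the norm of the fixed difference is then below a
    sequence tending to 0. [X] is rectangular so that it can be a basis of an invariant subspace. *)
Lemma expmx_intertwine n p (A : 'M[R[i]]_n) (B : 'M[R[i]]_p)
    (X : 'M[R[i]]_(n, p)) :
  A *m X = X *m B -> expmx A *m X = X *m expmx B.
Proof.
move=> AX.
have AXk k : A ^+ k *m X = X *m B ^+ k.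
  elim: k => [|k ih]; first by rewrite !expr0 mul1mx mulmx1.
  rewrite exprS exprSr -[A * _]/(A *m _) -[_ * B]/(_ *m B).
  by rewrite -mulmxA ih mulmxA AX -mulmxA -[B *m _]/(B * _) -exprS exprSr.
have SX N : expmx_sum A N *m X = X *m expmx_sum B N.
  rewrite /expmx_sum /series /= mulmx_suml mulmx_sumr.
  by apply: eq_bigr => k _; rewrite -scalemxAl -scalemxAr AXk.
apply/eqP; rewrite -subr_eq0; apply/eqP/mnorm_inf0_eq0/eqP.
rewrite eq_le mnorm_inf_ge0 andbT.
pose u N := mnorm_inf (expmx_sum A N - expmx A) * mnorm_inf X +
            mnorm_inf X * mnorm_inf (expmx_sum B N - expmx B).
have u0 : u N @[N --> \oo] --> (0 : R).
  rewrite -[X in _ --> X](addr0 (0 : R)); apply: cvgD.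
    by rewrite -[X in _ --> X](mul0r (mnorm_inf X)); apply: cvgMl;
      exact: expmx_cvg.
  by rewrite -[X in _ --> X](mulr0 (mnorm_inf X)); apply: cvgMr;
    exact: expmx_cvg.
apply: (cvgr_to_ge u0); near=> N.
have -> : expmx A *m X - X *m expmx B =
    X *m (expmx_sum B N - expmx B) - (expmx_sum A N - expmx A) *m X.
  by rewrite mulmxBl mulmxBr SX opprB [RHS]addrC addrA subrK.
by rewrite (le_trans (mnorm_infB _ _))// addrC lerD// mnorm_infM.
Unshelve. all: by end_near. Qed.

Lemma expmx0 n : expmx (0 : 'M[R[i]]_n) = 1%:M.
Proof.
apply/eqP; rewrite -subr_eq0 -oppr_eq0 opprB; apply/eqP/mnorm_inf0_eq0/eqP.
rewrite eq_le mnorm_inf_ge0 andbT.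
apply: (cvgr_to_ge (expmx_cvg (0 : 'M[R[i]]_n))); exists 1%N => // -[//|N] _ /=.
rewrite /expmx_sum /series /= big_nat_recl//= expr0 big1 ?addr0.
  by rewrite invr1 scale1r.
by move=> k _; rewrite exprS mul0r scaler0.
Qed.

(** The triangular part of a Cauchy product, summed by columns instead of diagonals. With scalars
    acting on a module, it covers both the matrix series and the real series that dominates it. *)
Lemma sum_triangle (K : pzRingType) (V : lmodType K) (f : nat -> K)
    (g : nat -> V) N :
  \sum_(0 <= k < N) \sum_(0 <= i < k.+1) f (k - i)%N *: g i =
  \sum_(0 <= i < N) (\sum_(0 <= j < N - i) f j) *: g i.
Proof.
elim: N => [|N ih]; first by rewrite !big_geq.
rewrite big_nat_recr//= ih.
transitivity (\sum_(0 <= i < N.+1)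
    ((\sum_(0 <= j < N - i) f j) *: g i + f (N - i)%N *: g i)).
  by rewrite big_split /= [in RHS]big_nat_recr//= subnn [\sum_(0 <= j < 0)
    _]big_geq// scale0r addr0.
apply: eq_big_nat => i /=.
by rewrite ltnS => iN; rewrite subSn// big_nat_recr//= scalerDl.
Qed.

Lemma inv_fact_bin (K : numFieldType) k i : (i <= k)%N ->
  (k`!%:R : K)^-1 *+ 'C(k, i) = (k - i)`!%:R^-1 * i`!%:R^-1.
Proof.
move=> ik; rewrite -(bin_fact ik) !natrM -mulr_natr.
have f0 j : (j`!%:R : K) != 0 by rewrite pnatr_eq0 -lt0n fact_gt0.
have b0 : ('C(k, i)%:R : K) != 0 by rewrite pnatr_eq0 -lt0n bin_gt0.
by field; rewrite b0 !f0.
Qed.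

Lemma expR_term_add (a b : R) k :
  exp_coeff (a + b) k =
  \sum_(0 <= i < k.+1) exp_coeff a (k - i)%N *: (exp_coeff b i : R^o).
Proof.
rewrite !exp_coeffE exprDn mulr_sumr big_mkord; apply: eq_bigr => i _.
rewrite /GRing.scale /= mulrnAr -mulrnAl inv_fact_bin; last by rewrite -ltnS.
by rewrite mulrACA.
Qed.

Lemma expmx_term_shift n (a : R[i]) (A : 'M[R[i]]_n) k :
  (k`!%:R : R[i])^-1 *: (a%:M + A) ^+ k =
  \sum_(0 <= i < k.+1) ((k - i)`!%:R^-1 * a ^+ (k - i)) *:
    ((i`!%:R : R[i])^-1 *: A ^+ i).
Proof.
rewrite exprDn_comm; last exact/esym/scalar_mxC.
rewrite scaler_sumr big_mkord; apply: eq_bigr => i _.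
have -> : a%:M ^+ (k - i) = (a ^+ (k - i))%:M :> 'M[R[i]]_n.
  elim: (k - i)%N => [|j ih]; first by rewrite !expr0.
  by rewrite !exprS ih -[_ * _]/(_ *m _) -scalar_mxM.
rewrite -[_%:M * _]/(_%:M *m _) mul_scalar_mx -scalerMnr scalerMnl.
by rewrite inv_fact_bin -1?ltnS// !scalerA mulrAC.
Qed.

(** A product of two partial sums runs over a square of indices, the partial sum of the product over
    a triangle. The difference is the rest of the square, bounded term by term by the same rest for
    real exponentials. *)
Lemma expmx_sum_shift_le n (a : R[i]) (A : 'M[R[i]]_n) N :
  mnorm_inf (expmx_sum (a%:M + A) N -
             (\sum_(0 <= j < N) j`!%:R^-1 * a ^+ j) *: expmx_sum A N) <=
  expR_sum (nc a) N * expR_sum (mnorm_inf A) N -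
  expR_sum (nc a + mnorm_inf A) N.
Proof.
pose f j : R[i] := j`!%:R^-1 * a ^+ j.
have fE j : nc (f j) = exp_coeff (nc a) j.
  by rewrite Normc.normcM normc_natV normcX exp_coeffE.
have -> : expmx_sum (a%:M + A) N = \sum_(0 <= i < N)
    (\sum_(0 <= j < N - i) f j) *: ((i`!%:R : R[i])^-1 *: A ^+ i).
  rewrite /expmx_sum /series /= -sum_triangle.
  by apply: eq_bigr => k _; rewrite expmx_term_shift.
have -> : expR_sum (nc a + mnorm_inf A) N = \sum_(0 <= i < N)
    (\sum_(0 <= j < N - i) exp_coeff (nc a) j) *:
      (exp_coeff (mnorm_inf A) i : R^o).
  rewrite /expR_sum /series /= -sum_triangle.
  by apply: eq_bigr => k _; rewrite expR_term_add.
rewrite mnorm_infBC scaler_sumr -sumrB mulr_sumr -sumrB.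
rewrite (le_trans (mnorm_inf_sum _ _ _))// big_nat [leRHS]big_nat.
apply: ler_sum => i /andP[_ iN];
  rewrite -scalerBl -[_ *: (_ : R^o)]/(_ * _) -mulrBl.
rewrite (le_trans (mnorm_infZ _ _))//.
have tail (V : zmodType) (u : nat -> V) :
    \sum_(0 <= j < N) u j - \sum_(0 <= j < N - i) u j = \sum_(N - i <= j < N) u
      j.
  rewrite (big_cat_nat (leq0n (N - i)) (leq_subr i N)) /=.
  by rewrite addrAC subrr add0r.
rewrite /expR_sum /series /= !tail ler_pM ?normc_ge0 ?mnorm_inf_ge0
  ?exp_term_le//.
by rewrite (le_trans (normc_sum _ _ _))// ler_sum// => j _; rewrite fE.
Qed.

Lemma expR_term_complex (a : R) j :
  ((j`!%:R : R[i])^-1 * a%:C ^+ j) = (exp_coeff a j)%:C.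
Proof.
rewrite exp_coeffE rmorphM /= fmorphV rmorphXn /=; congr (_^-1 * _).
by rewrite rmorph_nat.
Qed.

(** The rest of the square tends to 0 because [expR] turns sums into products: the functional
    equation over the reals yields the matrix one. *)
Lemma expmx_shift n (a : R) (A : 'M[R[i]]_n) :
  expmx (a%:C%:M + A) = (expR a)%:C *: expmx A.
Proof.
apply/eqP; rewrite -subr_eq0; apply/eqP/mnorm_inf0_eq0/eqP.
rewrite eq_le mnorm_inf_ge0 andbT.
pose B := a%:C%:M + A.
pose u N :=
  mnorm_inf (expmx_sum B N - expmx B) +
  (expR_sum `|a| N * expR_sum (mnorm_inf A) N - expR_sum (`|a| + mnorm_inf A)
    N) +
  (`|expR_sum a N| * mnorm_inf (expmx_sum A N - expmx A) +
   `|expR_sum a N - expR a| * mnorm_inf (expmx A)).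
have u0 : u N @[N --> \oo] --> (0 : R).
  rewrite [X in _ --> X](_ : 0 = 0 +
     (expR `|a| * expR (mnorm_inf A) - expR (`|a| + mnorm_inf A)) +
     (`|expR a| * 0 + 0 * mnorm_inf (expmx A))); last first.
    by rewrite expRD subrr mulr0 mul0r !addr0.
  apply: cvgD; apply: cvgD.
  - exact: expmx_cvg.
  - by apply: cvgB; [apply: cvgM|]; exact: expR_sum_cvg.
  - apply: cvgM; [apply: cvg_norm; exact: expR_sum_cvg|exact: expmx_cvg].
  - apply: cvgMl; apply/norm_cvg0P; rewrite -[X in _ --> X](subrr (expR a)).
    by apply: cvgB; [exact: expR_sum_cvg|exact: cvg_cst].
apply: (cvgr_to_ge u0); near=> N.
have -> : expmx B - (expR a)%:C *: expmx A =
  - (expmx_sum B N - expmx B) +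
  (expmx_sum B N - (expR_sum a N)%:C *: expmx_sum A N) +
  ((expR_sum a N)%:C *: (expmx_sum A N - expmx A) +
   (expR_sum a N - expR a)%:C *: expmx A).
  rewrite rmorphB scalerBl scalerBr !addrA opprB subrK.
  by rewrite -!addrA; congr (_ + _); rewrite addKr addKr.
apply: le_trans (mnorm_infD _ _) _; apply: lerD.
  apply: le_trans (mnorm_infD _ _) _; rewrite mnorm_infN lerD2l.
  have -> : (expR_sum a N)%:C = \sum_(0 <= j < N) (j`!%:R : R[i])^-1 * a%:C ^+
    j.
    rewrite /expR_sum /series /= rmorph_sum.
    by apply: eq_bigr => j _; rewrite expR_term_complex.
  by rewrite -(normc_real a); exact: expmx_sum_shift_le.
apply: le_trans (mnorm_infD _ _) _.
by rewrite lerD// (le_trans (mnorm_infZ _ _))// normc_real.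
Unshelve. all: by end_near.
Qed.

Lemma mnorm_expmx n (A : 'M[R[i]]_n) c :
  mnorm_inf A <= c -> mnorm_inf (expmx A) <= expR c.
Proof.
move=> Ac.
have h : mnorm_inf (expmx_sum A N - expmx A) + expR_sum c N @[N --> \oo] --> 0
  + expR c.
  by apply: cvgD; [exact: expmx_cvg|exact: expR_sum_cvg].
rewrite -[leRHS]add0r; apply: (cvgr_to_ge h); near=> N.
rewrite -{1}[expmx A](subKr (expmx_sum A N)) [leRHS]addrC.
apply: le_trans (mnorm_infB _ _) _; rewrite lerD//.
rewrite (le_trans (mnorm_inf_sum _ _ _))// ler_sum// => k _.
rewrite (le_trans (exp_term_le _ _))// !exp_coeffE ler_wpM2l ?invr_ge0//.
by rewrite lerXn2r// nnegrE ?mnorm_inf_ge0// (le_trans _ Ac)// mnorm_inf_ge0.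
Unshelve. all: by end_near.
Qed.

(** [A] and [D] need not commute: the difference consists of the words in [A] and [D] containing at
    least one [D], each bounded by the same word in [c] and [d]. The induction peels off the first
    letter. *)
Lemma mnorm_powerB n (A D : 'M[R[i]]_n) c d k :
  mnorm_inf A <= c -> mnorm_inf D <= d ->
  mnorm_inf ((A + D) ^+ k - A ^+ k) <= (c + d) ^+ k - c ^+ k.
Proof.
move=> Ac Dd.
have c0 : 0 <= c by exact: le_trans (mnorm_inf_ge0 A) Ac.
have d0 : 0 <= d by exact: le_trans (mnorm_inf_ge0 D) Dd.
elim: k => [|k ih]; first by rewrite !expr0 !subrr mnorm_inf0.
have -> : (A + D) ^+ k.+1 - A ^+ k.+1 = (A + D) *m ((A + D) ^+ k - A ^+ k) + D
  *m A ^+ k.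
  by rewrite !exprS mulmxBr [(A + D) *m A ^+ k]mulmxDl opprD addrA subrK.
have -> : (c + d) ^+ k.+1 - c ^+ k.+1 = (c + d) * ((c + d) ^+ k - c ^+ k) + d *
  c ^+ k.
  by rewrite !exprS; ring.
rewrite (le_trans (mnorm_infD _ _))// lerD// (le_trans (mnorm_infM _ _))//.
  by rewrite ler_pM ?mnorm_inf_ge0// (le_trans (mnorm_infD _ _))// lerD.
by rewrite ler_pM ?mnorm_inf_ge0// (le_trans (mnorm_infX _ _))// lerXn2r//
  nnegrE ?mnorm_inf_ge0.
Qed.

Lemma mnorm_expmxB n (A D : 'M[R[i]]_n) c d :
  mnorm_inf A <= c -> mnorm_inf D <= d ->
  mnorm_inf (expmx (A + D) - expmx A) <= expR (c + d) - expR c.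
Proof.
move=> Ac Dd.
have h : mnorm_inf (expmx_sum (A + D) N - expmx (A + D)) +
   mnorm_inf (expmx_sum A N - expmx A) +
   (expR_sum (c + d) N - expR_sum c N) @[N --> \oo] --> 0 + 0 + (expR (c + d) -
     expR c).
  apply: cvgD; first by apply: cvgD; exact: expmx_cvg.
  by apply: cvgB; exact: expR_sum_cvg.
rewrite -[leRHS]add0r -[X in X + (_ - _)]addr0; apply: (cvgr_to_ge h); near=> N.
have -> : expmx (A + D) - expmx A = - (expmx_sum (A + D) N - expmx (A + D)) +
   (expmx_sum A N - expmx A) + (expmx_sum (A + D) N - expmx_sum A N).
  by rewrite opprB addrAC !addrA !subrK.
apply: le_trans (mnorm_infD _ _) _; apply: lerD.
  by rewrite (le_trans (mnorm_infD _ _))// mnorm_infN.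
rewrite /expmx_sum /expR_sum /series /= -!sumrB.
rewrite (le_trans (mnorm_inf_sum _ _ _))// ler_sum// => k _.
rewrite -scalerBr (le_trans (mnorm_infZ _ _))// normc_natV !exp_coeffE -mulrBr.
by rewrite ler_wpM2l ?invr_ge0// mnorm_powerB.
Unshelve. all: by end_near.
Qed.

(** The crude bounds [expR c] and [expR (c + d) - expR c] hold for the shifted matrix; undoing the
    shift multiplies them by [expR (- c)], so [c], however large, disappears. *)
Lemma expmx_stable n (A D : 'M[R[i]]_n) (c d : R) :
  mnorm_inf (c%:C%:M + A) <= c -> mnorm_inf D <= d ->
  mnorm_inf (expmx A) <= 1 /\
  mnorm_inf (expmx (A + D) - expmx A) <= expR d - 1.
Proof.
move=> Ac Dd.
have shift (B : 'M[R[i]]_n) : expmx B = (expR (- c))%:C *: expmx (c%:C%:M + B).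
  rewrite -expmx_shift addrA -[X in _ = expmx (X + _)]raddfD /=.
  by rewrite -[(- c)%:C + c%:C]raddfD /= addNr [X in X + _]raddf0 add0r.
have enc : nc (expR (- c))%:C = expR (- c).
  by rewrite normc_real ger0_norm// expR_ge0.
split.
  rewrite shift (le_trans (mnorm_infZ _ _))// enc.
  rewrite -[leRHS](expR0) -[in leRHS](addNr c) expRD ler_wpM2l ?expR_ge0//.
  exact: mnorm_expmx.
rewrite shift [X in _ - X]shift -scalerBr (le_trans (mnorm_infZ _ _))// enc.
rewrite (_ : expR d - 1 = expR (- c) * (expR (c + d) - expR c)).
  by rewrite ler_wpM2l ?expR_ge0// addrA mnorm_expmxB.
by rewrite mulrBr -!expRD addKr addNr expR0.
Qed.

End MatrixExponential.

(** * Primitivity of the root of unity and inversion of the Fourier matrix *)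

Section Fourier.
Variable R : realType.

Lemma omegaX n k : omega R n ^+ k =
  cos (2 * pi / n%:R * k%:R) +i* sin (2 * pi / n%:R * k%:R).
Proof.
elim: k => [|k ih]; first by rewrite expr0 mulr0 cos0 sin0.
rewrite exprS ih /omega -[k.+1%:R]natr1 [_ * (k%:R + 1)]mulrDr mulr1 cosD sinD.
by apply/eqP; rewrite eq_complex /=; apply/andP; split; apply/eqP; ring.
Qed.

Lemma cos_neq1 (x : R) : 0 < x < 2 * pi -> cos x != 1.
Proof.
move=> /andP[x0 x2]; have x_half : x = x / 2 *+ 2 by rewrite -mulr_natr mulfVK.
rewrite x_half cos_mulr2n cos2sin2.
have s0 : 0 < sin (x / 2) by apply: sin_gt0_pi; lra.
rewrite lt_eqF//.
have : 0 < sin (x / 2) ^+ 2 by rewrite exprn_gt0.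
rewrite -mulr_natr; lra.
Qed.

(** A power with exponent strictly between 0 and [n] has its angle strictly between 0 and [2 * pi],
    where the cosine differs from 1. *)
Lemma omega_prim n : (0 < n)%N -> n.-primitive_root (omega R n).
Proof.
move=> n0; have n0' : (n%:R : R) != 0 by rewrite pnatr_eq0 -lt0n.
rewrite /primitive_root_of_unity n0 /=; apply/forallP => i;
  rewrite unity_rootE omegaX.
apply/eqP; have [->|ni] := eqVneq i.+1 n.
  by rewrite mulfVK// mulr_natl cos2pi sin2pi eqxx.
apply/negbTE; rewrite eq_complex /= negb_and cos_neq1//.
have pi0 := pi_gt0 R; have ltin : (i.+1 < n)%N by rewrite ltn_neqAle ni /=.
have n00 : 0 < n%:R :> R by rewrite ltr0n.
rewrite -mulrA; apply/andP; split; first by rewrite !mulr_gt0// invr_gt0.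
by rewrite gtr_pMr ?mulr_gt0// mulrC ltr_pdivrMr// mul1r ltr_nat.
Qed.

Lemma normc_omega n : nc (omega R n) = 1.
Proof. by rewrite /omega /Normc.normc cos2Dsin2 sqrtr1. Qed.

Lemma conjc_omega n : (omega R n)^* = (omega R n)^-1.
Proof.
have w0 : omega R n != 0 by rewrite -normc_eq0 normc_omega oner_eq0.
by apply: (mulfI w0); rewrite divff// mulcJ normc_omega expr1n.
Qed.

(** A geometric sum: its ratio [x] satisfies [x ^+ n = 1], and primitivity gives [x != 1] when
    [k != l]. *)
Lemma omega_orthogonal n (k l : 'I_n) :
  \sum_(j < n) ((omega R n)^-1 ^+ k * omega R n ^+ l) ^+ j = n%:R *+ (k == l).
Proof.
have n0 : (0 < n)%N by case: n k l => [[]|].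
have prim := omega_prim n0; set w := omega R n in prim *.
have w0 : w != 0 by rewrite -normc_eq0 normc_omega oner_eq0.
set x := _ * _; have [kl|kl] := eqVneq k l.
  have -> : x = 1 by rewrite /x kl exprVn mulVf// expf_neq0.
  by under eq_bigr do rewrite expr1n; rewrite sumr_const card_ord mulr1n.
have x1 : x - 1 != 0.
  rewrite subr_eq0; apply: contra kl => /eqP x1; apply/eqP/val_inj => /=.
  have : w ^+ k == w ^+ l.
    by rewrite -[X in X == _]mulr1 -x1 /x exprVn mulrA divff ?mul1r// expf_neq0.
  by rewrite (eq_prim_root_expr prim) !modn_small// => /eqP.
apply: (mulfI x1); rewrite mulr0n mulr0 -subrX1 /x exprMn.
rewrite exprAC [in X in _ * X]exprAC exprVn (prim_expr_order prim).
by rewrite invr1 !expr1n mulr1 subrr.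
Qed.

Lemma fourierHE n (i j : 'I_n) : fourierH R n i j = (omega R n)^-1 ^+ (i * j).
Proof. rewrite !mxE -conjc_omega mulnC; exact: rmorphXn. Qed.

Lemma fourierHK n : fourierH R n *m fourier R n = n%:R%:M.
Proof.
apply/matrixP => k l; rewrite !mxE -omega_orthogonal; apply: eq_bigr => j _.
by rewrite fourierHE mxE exprMn -!exprM [(l * j)%N]mulnC.
Qed.

Lemma fourierK n : fourier R n *m fourierH R n = n%:R%:M.
Proof.
apply/matrixP => k l; rewrite !mxE eq_sym -omega_orthogonal.
apply: eq_bigr => j _.
by rewrite fourierHE mxE exprMn -!exprM mulrC [(j * l)%N]mulnC.
Qed.

End Fourier.

(** * The Euclidean norm and its scaling by the square root of [n] under both transforms *)

Section EuclideanNorm.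
Variable R : realType.

Lemma vnorm2_ge0 n (x : 'cV[R[i]]_n) : 0 <= vnorm2 x.
Proof. exact: sqrtr_ge0. Qed.

Lemma vnorm2_sqr n (x : 'cV[R[i]]_n) : vnorm2 x ^+ 2 = \sum_i nc (x i 0) ^+ 2.
Proof. by rewrite sqr_sqrtr// sumr_ge0// => i _; exact: sqr_ge0. Qed.

Lemma vnorm2_le n (x : 'cV[R[i]]_n) b :
  0 <= b -> \sum_i nc (x i 0) ^+ 2 <= b ^+ 2 -> vnorm2 x <= b.
Proof.
by move=> b0 xb; rewrite -(@ler_pXn2r _ 2) ?nnegrE ?vnorm2_ge0// vnorm2_sqr.
Qed.

Lemma entry_le_vnorm2 n (x : 'cV[R[i]]_n) i : nc (x i 0) <= vnorm2 x.
Proof.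
rewrite -(@ler_pXn2r _ 2) ?nnegrE ?vnorm2_ge0 ?normc_ge0// vnorm2_sqr.
by rewrite (bigD1 i)//= lerDl sumr_ge0// => *; exact: sqr_ge0.
Qed.

Lemma vnorm2_le_max n (x : 'cV[R[i]]_n) b :
  0 <= b -> (forall i, nc (x i 0) <= b) -> vnorm2 x <= Num.sqrt n%:R * b.
Proof.
move=> b0 xb; apply: vnorm2_le; first by rewrite mulr_ge0 ?sqrtr_ge0.
rewrite exprMn sqr_sqrtr// mulr_natl -[in leRHS](card_ord n) -sumr_const.
by apply: ler_sum => i _; rewrite ler_pXn2r ?nnegrE ?normc_ge0.
Qed.

Lemma cauchy_schwarz (I : finType) (a b : I -> R) :
  \sum_i a i * b i <=
  Num.sqrt (\sum_i a i ^+ 2) * Num.sqrt (\sum_i b i ^+ 2).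
Proof.
set A := \sum_i a i ^+ 2; set B := \sum_i b i ^+ 2.
have A0 : 0 <= A by apply: sumr_ge0 => i _; exact: sqr_ge0.
have B0 : 0 <= B by apply: sumr_ge0 => i _; exact: sqr_ge0.
have zero (c d : I -> R) : \sum_i c i ^+ 2 = 0 -> \sum_i c i * d i = 0.
  move=> c0; rewrite big1// => i _; have /eqP := c0.
  rewrite psumr_eq0; last by move=> *; exact: sqr_ge0.
  by move=> /allP/(_ i (mem_index_enum i)); rewrite /= sqrf_eq0 => /eqP ->;
    rewrite mul0r.
have [/zero ->|Apos] := eqVneq A 0; first by rewrite mulr_ge0 ?sqrtr_ge0.
have [/zero Bz|Bpos] := eqVneq B 0.
  by under eq_bigr do rewrite mulrC; rewrite Bz mulr_ge0 ?sqrtr_ge0.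
set s := Num.sqrt A; set t := Num.sqrt B.
have s0 : 0 < s by rewrite sqrtr_gt0 lt_neqAle eq_sym Apos.
have t0 : 0 < t by rewrite sqrtr_gt0 lt_neqAle eq_sym Bpos.
have sA : s ^+ 2 = A by rewrite sqr_sqrtr.
have tB : t ^+ 2 = B by rewrite sqr_sqrtr.
(* AM-GM: [2 a b <= (t / s) a^2 + (s / t) b^2] *)
apply: (@le_trans _ _ (\sum_i (t / s * a i ^+ 2 + s / t * b i ^+ 2) / 2)).
  apply: ler_sum => i _; rewrite -subr_ge0.
  have -> : (t / s * a i ^+ 2 + s / t * b i ^+ 2) / 2 - a i * b i =
      (t * a i - s * b i) ^+ 2 / (2 * s * t) by field; rewrite !lt0r_neq0.
  by rewrite divr_ge0 ?sqr_ge0// !mulr_ge0// ltW.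
rewrite -mulr_suml big_split /= -!mulr_sumr -/A -/B -sA -tB.
by rewrite le_eqVlt; apply/orP; left; apply/eqP; field; rewrite !lt0r_neq0.
Qed.

Lemma vnorm2D n (x y : 'cV[R[i]]_n) : vnorm2 (x + y) <= vnorm2 x + vnorm2 y.
Proof.
apply: vnorm2_le; first by rewrite addr_ge0 ?vnorm2_ge0.
apply: (@le_trans _ _ (\sum_i (nc (x i 0) + nc (y i 0)) ^+ 2)).
  apply: ler_sum => i _.
  by rewrite ler_pXn2r ?nnegrE ?addr_ge0 ?normc_ge0// mxE normcD.
under eq_bigr do rewrite sqrrD; rewrite !big_split /= sqrrD !vnorm2_sqr.
rewrite lerD2r lerD2l -mulr2n lerMn2r /=.
exact: cauchy_schwarz.
Qed.

Lemma vnorm2N n (x : 'cV[R[i]]_n) : vnorm2 (- x) = vnorm2 x.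
Proof.
congr (Num.sqrt _); apply: eq_bigr => i _; rewrite mxE; congr (_ ^+ 2).
exact: normcN.
Qed.

Lemma vnorm2_unitary n (A : 'M[R[i]]_n) (x : 'cV[R[i]]_n) :
  (map_mx conjc A)^T *m A = n%:R%:M ->
  vnorm2 (A *m x) = Num.sqrt n%:R * vnorm2 x.
Proof.
move=> AA.
have gram (y : 'cV[R[i]]_n) :
    (\sum_i nc (y i 0) ^+ 2)%:C = ((map_mx conjc y)^T *m y) 0 0.
  rewrite mxE rmorph_sum /=; apply: eq_bigr => i _.
  by rewrite !mxE mulrC mulcJ.
rewrite -sqrtrM//; congr Num.sqrt; apply: (@complexI R).
rewrite gram rmorphM /= gram map_mxM trmx_mul -!mulmxA (mulmxA _ A) AA.
by rewrite mul_scalar_mx -scalemxAr mxE rmorph_nat.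
Qed.

Lemma vnorm2_fourier n (x : 'cV[R[i]]_n) :
  vnorm2 (fourier R n *m x) = Num.sqrt n%:R * vnorm2 x.
Proof. by apply: vnorm2_unitary; exact: fourierHK. Qed.

Lemma vnorm2_fourierH n (x : 'cV[R[i]]_n) :
  vnorm2 (fourierH R n *m x) = Num.sqrt n%:R * vnorm2 x.
Proof.
apply: vnorm2_unitary; rewrite -[RHS]fourierK; congr (_ *m _).
by apply/matrixP => i j; rewrite !mxE conjcK mulnC.
Qed.

End EuclideanNorm.

(** * Symbols of block-circulant matrices and the subgenerator property *)

Section BlockCirculant.
Variable R : realType.

Lemma blk_ord (K : pzRingType) n m (U : 'I_n -> 'M[K]_m) (h : 'I_n) :
  blk U h = U h.
Proof. by rewrite /blk valK. Qed.

(** The symbol of the circulant matrix: its values at the [n]-th roots of [e] are the [m x m]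
    matrices that the algorithm exponentiates. *)
Definition blkpoly (K : pzRingType) n m (U : 'I_n -> 'M[K]_m) (z : K) :
  'M[K]_m := \sum_(h < n) z ^+ h *: U h.

(* For [z ^+ n = e] the columns of [powcol] span an invariant subspace of the
   block-e-circulant matrix. *)
Definition powcol (K : pzRingType) n m (z : K) : 'M[K]_(\sum_(i < n) m, m) :=
  \mxcol_(i < n) (z ^+ i)%:M.

Lemma mul_powcol (K : pzRingType) n m (z : K) (A : 'M[K]_m) :
  powcol n m z *m A = \mxcol_(i < n) (z ^+ i *: A).
Proof.
apply/matrixP => k s; rewrite [RHS]mxE -mul_scalar_mx !mxE.
by apply: eq_bigr => j _; rewrite !mxE.
Qed.

Lemma circulant_powcol (K : comPzRingType) n m (U : 'I_n.+1 -> 'M[K]_m) (z : K)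
  :
  block_circulant (z ^+ n.+1) U *m powcol n.+1 m z =
  powcol n.+1 m z *m blkpoly U z.
Proof.
rewrite mul_powcol mul_mxblock_mxrow; apply: eq_mxcol => i.
(* Addition in ['I_n.+1] is modular: the block in row [i] and column [i + h] is [U h], up to the
   factor [z ^+ n.+1] after a wrap. *)
rewrite /blkpoly scaler_sumr (reindex_inj (addrI i)) /=.
apply: eq_bigr => h _; rewrite scalerA -exprD mul_mx_scalar.
have [ih|ih] := ltnP (i + h) n.+1.
  by rewrite modn_small// leq_addr addKn blk_ord.
(* On a wrap the column index drops by [n.+1], and the factor [z ^+ n.+1] of the lower blocks
   restores the exponent [i + h]. *)
have -> : ((i + h) %% n.+1 = i + h - n.+1)%N.
  by rewrite -[in LHS](subnK ih) modnDr modn_small// ltn_subLR// -addSn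
    leq_add// ltnW.
have lti : (i + h - n.+1 < i)%N by rewrite ltn_subLR// addnC ltn_add2r.
rewrite leqNgt lti /= addnBA// addKn.
by rewrite addKn blk_ord scalerA -exprD subnK.
Qed.

(** The top block of [powcol] is the identity, so the intertwined equation read in block row 0 is
    the claim. *)
Lemma expmx_circulant n m (U Y : 'I_n.+1 -> 'M[R[i]]_m) (z : R[i]) :
  block_circulant (z ^+ n.+1) Y = expmx (block_circulant (z ^+ n.+1) U) ->
  blkpoly Y z = expmx (blkpoly U z).
Proof.
move=> YU; have := expmx_intertwine (circulant_powcol U z).
rewrite -YU circulant_powcol !mul_powcol => /eq_mxcolP/(_ ord0).
by rewrite expr0 !scale1r.
Qed.

Lemma toeplitzE (K : pzRingType) n m (U : 'I_n.+1 -> 'M[K]_m) (h : 'I_n.+1) r s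
  :
  block_toeplitz U (tagnat.Rank (ord0 : 'I_n.+1) r) (tagnat.Rank h s) = U h r s.
Proof.
have := congr1 (fun M : 'M[K]_m => M r s) (mxblockK (fun i j : 'I_n.+1 =>
  if (i <= j)%N then blk U (j - i) else 0) ord0 h).
by rewrite mxE => ->; rewrite /= subn0 blk_ord.
Qed.

(** The first block row contains every [U h]. Only [U ord0] meets the diagonal there, so the other
    blocks are entrywise nonnegative, and the row sums run over all blocks together. *)
Lemma subgenerator_blocks n m (U : 'I_n.+1 -> 'M[R]_m) :
  subgenerator (block_toeplitz U) ->
  [/\ forall r s, r != s -> 0 <= U ord0 r s,
      forall h r s, h != ord0 -> 0 <= U h r s &
      forall r, \sum_s \sum_h U h r s <= 0].
Proof.
move=> [off _ rows]; split => [r s rs|h r s h0|r].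
- rewrite -toeplitzE off//; apply: contra rs => /eqP/val_eqP /=.
  by rewrite tagnat.eq_Rank eqxx.
- rewrite -toeplitzE off//; apply: contra h0 => /eqP/val_eqP /=.
  by rewrite tagnat.eq_Rank eq_sym => /andP[].
- have := rows (tagnat.Rank (ord0 : 'I_n.+1) r).
  rewrite (reindex _ (onW_bij _ (@tagnat.rank_bij _ (fun=> m)))) /=.
  rewrite exchange_big /= (sig_big_dep xpredT (fun _ _ => true)) /=.
  congr (_ <= 0); apply: eq_bigr => -[h s] _ /=.
  by rewrite tagnat.rankE toeplitzE.
Qed.

(** [c] dominates each diagonal entry of [U ord0] in modulus, so adding it makes all entries
    nonnegative. In the unit disc moduli are then largest at [z = 1], where a row sum is [c] plus a
    nonpositive number. *)
Lemma subgenerator_blkpoly n m (U : 'I_n.+1 -> 'M[R]_m) :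
  subgenerator (block_toeplitz U) ->
  exists c : R, forall z : R[i], nc z <= 1 ->
    mnorm_inf (c%:C%:M + blkpoly (fun h => map_mx (real_complex R) (U h)) z)
      <= c.
Proof.
move=> /subgenerator_blocks[off pos rows].
pose c := \sum_r `|U ord0 r r|.
have c0 : 0 <= c by exact: sumr_ge0.
have cU r s : 0 <= c *+ (r == s) + U ord0 r s.
  have [<-|rs] := eqVneq r s; last by rewrite add0r off.
  rewrite mulr1n -[U _ _ _]opprK subr_ge0 (le_trans (ler_norm _))// normrN /c
    (bigD1 r)//=.
  by rewrite lerDl sumr_ge0.
exists c => z z1; apply: mnorm_inf_le => // r.
apply: (@le_trans _ _ (\sum_s (c *+ (r == s) + \sum_h U h r s))); last first.
  rewrite big_split /= -[leRHS]addr0 lerD//.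
  by rewrite (bigD1 r)//= eqxx big1 ?addr0// => s; rewrite eq_sym => /negbTE ->.
apply: ler_sum => s _; rewrite mxE summxE [in leRHS]big_ord_recl addrA.
rewrite [X in nc (_ + X)]big_ord_recl addrA (le_trans (normcD _ _))// lerD//.
  rewrite !mxE expr0 mul1r -(rmorphMn (real_complex R)) -(rmorphD (real_complex
    R)) normc_real.
  by rewrite ger0_norm.
rewrite (le_trans (normc_sum _ _ _))// ler_sum// => h _.
rewrite !mxE Normc.normcM normc_real normcX ger0_norm ?pos//.
by rewrite ler_piMl ?pos// exprn_ile1 ?normc_ge0.
Qed.

End BlockCirculant.

(** * Calculus of first-order bounds as the precision tends to 0 from above *)

Section FirstOrder.
Variable R : realType.
Implicit Types (f g : R -> R) (a b : R).

(** Nonnegativity is part of the notion because products and quotients of bounds are monotone only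
    on nonnegative values. *)
Definition first_order f a := exists C : R, \forall mu \near 0^'+,
  0 <= f mu <= a * mu + C * mu ^+ 2.

Lemma first_order_le f g a : (\forall mu \near 0^'+, 0 <= g mu <= f mu) ->
  first_order f a -> first_order g a.
Proof.
move=> gf [C fC]; exists C; near=> mu.
have /andP[g0 gfmu] : 0 <= g mu <= f mu by near: mu.
have /andP[_ fmu] : 0 <= f mu <= a * mu + C * mu ^+ 2 by near: mu.
by rewrite g0 (le_trans gfmu).
Unshelve. all: by end_near.
Qed.

Lemma first_order_weaken f a b : a <= b -> first_order f a -> first_order f b.
Proof.
move=> ab [C fC]; exists C; near=> mu.
have /andP[f0 fmu] : 0 <= f mu <= a * mu + C * mu ^+ 2 by near: mu.
have mu0 : 0 < mu by near: mu; exact: nbhs_right_gt.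
by rewrite f0 (le_trans fmu)// lerD2r ler_wpM2r// ltW.
Unshelve. all: by end_near.
Qed.

Lemma first_order_id : first_order id 1.
Proof.
exists 0; near=> mu.
have mu0 : 0 < mu by near: mu; exact: nbhs_right_gt.
by rewrite mul1r mul0r addr0 lexx ltW.
Unshelve. all: by end_near.
Qed.

Lemma first_orderD f g a b : first_order f a -> first_order g b ->
  first_order (fun mu => f mu + g mu) (a + b).
Proof.
move=> [C fC] [D gD]; exists (C + D); near=> mu.
have /andP[f0 fmu] : 0 <= f mu <= a * mu + C * mu ^+ 2 by near: mu.
have /andP[g0 gmu] : 0 <= g mu <= b * mu + D * mu ^+ 2 by near: mu.
by rewrite addr_ge0//= !mulrDl addrACA lerD.
Unshelve. all: by end_near.
Qed.

Lemma first_orderZ c f a : 0 <= c -> first_order f a ->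
  first_order (fun mu => c * f mu) (c * a).
Proof.
move=> c0 [C fC]; exists (c * C); near=> mu.
have /andP[f0 fmu] : 0 <= f mu <= a * mu + C * mu ^+ 2 by near: mu.
by rewrite mulr_ge0//= -!mulrA -mulrDr ler_wpM2l.
Unshelve. all: by end_near.
Qed.

Lemma first_order_linear f a : first_order f a ->
  exists2 K : R, 0 < K & \forall mu \near 0^'+, 0 <= f mu <= K * mu.
Proof.
move=> [C fC]; exists (`|a| + `|C| + 1).
  by rewrite ltr_wpDl// addr_ge0.
near=> mu.
have /andP[f0 fmu] : 0 <= f mu <= a * mu + C * mu ^+ 2 by near: mu.
have mu0 : 0 < mu by near: mu; exact: nbhs_right_gt.
have mu1 : mu < 1 by near: mu; exact: nbhs_right_lt.
rewrite f0 (le_trans fmu)// !mulrDl mul1r.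
have h1 : a * mu <= `|a| * mu by rewrite ler_wpM2r ?ler_norm// ltW.
have h2 : C * mu ^+ 2 <= `|C| * mu.
  apply: (@le_trans _ _ (`|C| * mu ^+ 2)).
    by rewrite ler_wpM2r ?ler_norm// sqr_ge0.
  by rewrite ler_wpM2l// expr2 ler_piMl// ltW.
by rewrite (le_trans (lerD h1 h2))// lerDl ltW.
Unshelve. all: by end_near.
Qed.

(** Coefficient 0 expresses a purely quadratic bound: this is how all cross terms drop out. *)
Lemma first_orderM f g a b : first_order f a -> first_order g b ->
  first_order (fun mu => f mu * g mu) 0.
Proof.
move=> /first_order_linear[K K0 fK] /first_order_linear[L L0 gL].
exists (K * L); near=> mu.
have /andP[f0 fmu] : 0 <= f mu <= K * mu by near: mu.
have /andP[g0 gmu] : 0 <= g mu <= L * mu by near: mu.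
by rewrite mulr_ge0//= mul0r add0r expr2 mulrACA ler_pM.
Unshelve. all: by end_near.
Qed.

Lemma first_order_lt f a e : 0 < e -> first_order f a ->
  \forall mu \near 0^'+, 0 <= f mu < e.
Proof.
move=> e0 /first_order_linear[K K0 fK]; near=> mu.
have /andP[f0 fmu] : 0 <= f mu <= K * mu by near: mu.
have mue : mu < e / K by near: mu; apply: nbhs_right_lt; rewrite divr_gt0.
by rewrite f0 (le_lt_trans fmu)// mulrC -ltr_pdivlMr.
Unshelve. all: by end_near.
Qed.

(** Once [f < 1/2], the identity [f / (1 - f) = f + f^2 / (1 - f)] bounds the quotient by
    [f + 2 f^2]. *)
Lemma first_order_div f a : first_order f a ->
  first_order (fun mu => f mu / (1 - f mu)) a.
Proof.
move=> fa; have half : (0 : R) < 2^-1 by rewrite invr_gt0.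
have f_lt := first_order_lt half fa.
apply: (@first_order_le (fun mu => f mu + 2 * (f mu * f mu))); last first.
  rewrite -[a]addr0 -(mulr0 2); apply: first_orderD => //.
  by apply: first_orderZ => //; exact: (first_orderM fa fa).
near=> mu.
have /andP[f0 f2] : 0 <= f mu < 2^-1 by near: mu.
have d0 : 0 < 1 - f mu by lra.
rewrite divr_ge0 ?(ltW d0)//= ler_pdivrMr//; nra.
Unshelve. all: by end_near.
Qed.

(** From [expR (- f) >= 1 - f] follows [expR f - 1 <= f / (1 - f)], which reduces the claim to the
    quotient. *)
Lemma first_order_expR f a : first_order f a ->
  first_order (fun mu => expR (f mu) - 1) a.
Proof.
move=> fa; apply: (first_order_le _ (first_order_div fa)).
have f_lt := first_order_lt ltr01 fa.
near=> mu.
have /andP[f0 f1] : 0 <= f mu < 1 by near: mu.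
have d0 : 0 < 1 - f mu by rewrite subr_gt0.
have e1 : 1 <= expR (f mu) by rewrite -[leLHS](expR0 R) ler_expR.
rewrite subr_ge0 e1 /= lerBlDr.
have -> : f mu / (1 - f mu) + 1 = (1 - f mu)^-1 by field; rewrite lt0r_neq0.
rewrite -[leLHS]invrK lef_pV2 ?posrE ?invr_gt0 ?expR_gt0// -expRN.
exact: expR_ge1Dx.
Unshelve. all: by end_near.
Qed.

End FirstOrder.

(** * The constants [zeta] and [gamma] as first-order coefficients *)

Section RelativeErrors.
Variable R : realType.

(** Bound on [(1 + sigma) (1 + eta) - 1], with [sigma] from the stored power of [theta] and [eta]
    from the multiplication. Its linear part is the origin of [zeta]. *)
Definition mul_err (mu : R) : R :=
  mu + (Num.sqrt 2 * (2 * mu / (1 - 2 * mu)) +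
        mu * (Num.sqrt 2 * (2 * mu / (1 - 2 * mu)))).

Lemma first_order_mul_err : first_order mul_err (1 + 2 * Num.sqrt 2).
Proof.
have two : first_order (fun mu : R => 2 * mu) 2.
  by rewrite -[X in first_order _ X]mulr1;
    exact: first_orderZ (first_order_id R).
have eta := first_orderZ (sqrtr_ge0 2) (first_order_div two).
rewrite [2 * _]mulrC -[_ * 2]addr0.
apply: first_orderD; first exact: first_order_id.
by apply: first_orderD => //; exact: first_orderM (first_order_id R) eta.
Qed.

(** In [gamma] the 1 is the leading [mu] of [fft_eta], and [4 sqrt 2] the linear part of its product
    term. *)
Lemma first_order_fft_bound q :
  first_order (@fft_bound R q) (q%:R * (4 * Num.sqrt 2 + 1)).
Proof.
suff eta : first_order (@fft_eta R) (4 * Num.sqrt 2 + 1).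
  exact: (first_order_div (first_orderZ (ler0n _ q) eta)).
have four : first_order (fun mu : R => 4 * mu) 4.
  by rewrite -[X in first_order _ X]mulr1;
    exact: first_orderZ (first_order_id R).
have h := first_orderD (first_order_id R)
  (first_orderD (first_orderZ (sqrtr_ge0 2) (first_order_div four))
                (first_orderM (first_order_id R) (first_order_div four))).
rewrite addr0 addrC [_ * 4]mulrC in h.
have -> : @fft_eta R = (fun mu => mu + (Num.sqrt 2 * (4 * mu / (1 - 4 * mu)) +
    mu * (4 * mu / (1 - 4 * mu)))).
  by apply/funext => mu; rewrite /fft_eta mulrDl.
exact: h.
Qed.

Lemma mul_err_bound (mu : R) (s e : R[i]) :
  nc s <= mu -> nc e <= 2 * Num.sqrt 2 / (1 - 2 * mu) * mu ->
  nc ((1 + s) * (1 + e) - 1) <= mul_err mu.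
Proof.
move=> smu emu.
have e' : nc e <= Num.sqrt 2 * (2 * mu / (1 - 2 * mu)).
  by apply: (le_trans emu); rewrite le_eqVlt; apply/orP; left; apply/eqP; ring.
have -> : (1 + s) * (1 + e) - 1 = s + (e + s * e) by ring.
apply: le_trans (normcD _ _) _; rewrite lerD//.
apply: le_trans (normcD _ _) _; rewrite lerD// Normc.normcM.
by rewrite ler_pM ?normc_ge0.
Qed.

Lemma log2_exp2 q : log2 ((2 ^ q)%N%:R : R) = q%:R.
Proof.
have ln2 : ln (2 : R) != 0 by rewrite gt_eqF// ln_gt0// ltr1n.
by rewrite /log2 natrX lnXn// -[_ *+ q]mulr_natl mulfK.
Qed.

End RelativeErrors.

(** * Exact error bounds for each step of the algorithm at a fixed precision *)

Section ErrorBound.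
Variables (R : realType) (q n m : nat).
Local Notation N := n.+1.
Variables (U Y : 'I_N -> 'M[R[i]]_m) (theta : R[i]) (tau mu maxU maxY : R).
Variable fl : fl_arith R N m.
Hypothesis flP : fl_model q theta tau mu fl.
Hypothesis theta_neq0 : theta != 0.
Hypothesis theta_le1 : nc theta <= 1.
Hypotheses (mu_ge0 : 0 <= mu) (tau_ge0 : 0 <= tau).
Local Notation z := (mul_err mu).
Local Notation g := (fft_bound q mu).
Hypotheses (z_ge0 : 0 <= z) (g_ge0 : 0 <= g).
Hypothesis maxUP : forall h r s, nc (U h r s) <= maxU.
Hypothesis maxU_ge0 : 0 <= maxU.
Hypothesis maxYP : forall h, mnorm_inf (Y h) <= maxY.
Local Notation w := (omega R N).
Local Notation node k := (theta * w^-1 ^+ k).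
Hypothesis YU : forall k : nat, blkpoly Y (node k) = expmx (blkpoly U (node k)).
Variable c : R.
Hypothesis Uc : forall x : R[i], nc x <= 1 ->
  mnorm_inf (c%:C%:M + blkpoly U x) <= c.

Let maxY_ge0 : 0 <= maxY.
Proof. exact: le_trans (mnorm_inf_ge0 (Y ord0)) (maxYP ord0). Qed.

(** The exponent is an integer so that both scalings, by [theta ^ k] and by [theta ^ (- k)], are
    covered. *)
Lemma fl_scale (k : int) (x : R[i]) : (`|k| < N)%N ->
  nc (fl_mul fl (fl_theta fl k) x - theta ^ k * x) <= z * nc (theta ^ k * x).
Proof.
move=> kN; have [s sP ->] := fl_thetaP flP kN.
have [e eP ->] := fl_mulP flP (theta ^ k * (1 + s)) x.
have -> : theta ^ k * (1 + s) * x * (1 + e) - theta ^ k * x =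
  ((1 + s) * (1 + e) - 1) * (theta ^ k * x) by ring.
by rewrite Normc.normcM ler_wpM2r ?normc_ge0// mul_err_bound.
Qed.

Definition Zhat (k : 'I_N) : 'M[R[i]]_m :=
  \matrix_(r, s) fl_mul fl (fl_theta fl k%:Z) (U k r s).
Definition Vhat (k : 'I_N) : 'M[R[i]]_m :=
  \matrix_(r, s) fl_FH fl (\col_j Zhat j r s) k 0.
Definition What (k : 'I_N) : 'M[R[i]]_m := fl_exp fl (Vhat k).
Definition Rhat (k : 'I_N) : 'M[R[i]]_m :=
  \matrix_(r, s) (fl_F fl (\col_j What j r s) k 0 / N%:R).

Lemma algorithmAE k : algorithmA fl U k =
  \matrix_(r, s) fl_mul fl (fl_theta fl (- k%:Z)) (Rhat k r s).
Proof. by []. Qed.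

(** The link between the transforms and the symbol: applied to [U] it gives the exact matrices to
    exponentiate, applied to [Y] their exact exponentials. *)
Lemma fft_col (X : 'I_N -> 'M[R[i]]_m) (k : 'I_N) r s :
  (fourierH R N *m \col_j (theta ^+ j *: X j) r s) k 0 =
  blkpoly X (node k) r s.
Proof.
rewrite mxE summxE; apply: eq_bigr => j _.
by rewrite fourierHE !mxE mulrA exprMn -exprM [theta ^+ j * _]mulrC.
Qed.

(** The scaling error goes through the exact transform, and the FFT adds an error relative to its
    result. In both terms one [sqrt n] comes from the transform and one from passing from entries to
    the Euclidean norm; [m] comes from the row sum. *)
Lemma Vhat_err k :
  mnorm_inf (Vhat k - blkpoly U (node k)) <= m%:R * (N%:R * maxU * (g * (1 + z)
    + z)).
Proof.
have b0 : 0 <= N%:R * maxU * (g * (1 + z) + z).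
  by rewrite !mulr_ge0// addr_ge0// mulr_ge0// addr_ge0.
apply: mnorm_inf_le_max => // r s.
pose x := \col_j (theta ^+ j *: U j) r s; pose xh := \col_j Zhat j r s.
have xP j : nc (x j 0) <= maxU.
  rewrite !mxE Normc.normcM normcX -[leRHS]mul1r ler_pM ?exprn_ge0 ?normc_ge0//.
  by rewrite exprn_ile1 ?normc_ge0.
have dP j : nc ((xh - x) j 0) <= z * maxU.
  have jN : (`|j%:Z| < N)%N by rewrite absz_nat.
  rewrite !mxE exprnP (le_trans (fl_scale _ jN))//.
  by rewrite ler_wpM2l//; have := xP j; rewrite !mxE exprnP.
have xhP j : nc (xh j 0) <= (1 + z) * maxU.
  have -> : xh j 0 = x j 0 + (xh - x) j 0 by rewrite [X in _ + X]mxE [X in _ +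
    (_ + X)]mxE addrC subrK.
  by rewrite mulrDl mul1r (le_trans (normcD _ _))// lerD.
have -> : (Vhat k - blkpoly U (node k)) r s =
    (- (fourierH R N *m xh - fl_FH fl xh) + fourierH R N *m (xh - x)) k 0.
  by rewrite mulmxBr opprB addrA subrK [RHS]mxE [LHS]mxE [in RHS]mxE fft_col
    [in LHS]mxE [(- blkpoly _ _) r s]mxE.
apply: le_trans (entry_le_vnorm2 _ _) _.
apply: le_trans (vnorm2D _ _) _; rewrite vnorm2N.
apply: le_trans (lerD (fl_FHP flP xh) (lexx _)) _.
rewrite !vnorm2_fourierH.
have -> : N%:R * maxU * (g * (1 + z) + z) =
  g * (Num.sqrt N%:R * (Num.sqrt N%:R * ((1 + z) * maxU))) +
  Num.sqrt N%:R * (Num.sqrt N%:R * (z * maxU)).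
  by rewrite !(mulrA (Num.sqrt _)) -expr2 sqr_sqrtr//; ring.
rewrite lerD//.
  rewrite ler_wpM2l// ler_wpM2l ?sqrtr_ge0// vnorm2_le_max//.
  by rewrite mulr_ge0// addr_ge0.
by rewrite ler_wpM2l ?sqrtr_ge0// vnorm2_le_max// mulr_ge0.
Qed.

Lemma node_le1 k : nc (node k) <= 1.
Proof. by rewrite Normc.normcM normcX Normc.normcV normc_omega invr1 expr1n
  mulr1. Qed.

(** The error is split at [expmx (Vhat k)]. The algorithmic part is relative to that exponential,
    whose norm is at most [1 + (expR d - 1)]. *)
Lemma What_err (d : R) k : mnorm_inf (Vhat k - blkpoly U (node k)) <= d ->
  mnorm_inf (What k - expmx (blkpoly U (node k))) <=
  mu * tau * expR d + (expR d - 1).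
Proof.
move=> Vd; set V := blkpoly U _ in Vd *.
have VE : Vhat k = V + (Vhat k - V) by rewrite addrC subrK.
have [E1 Ed] := expmx_stable (Uc (node_le1 k)) Vd; rewrite -/V -VE in E1 Ed.
have -> : What k - expmx V = (What k - expmx (Vhat k)) + (expmx (Vhat k) -
  expmx V).
  by rewrite addrA subrK.
apply: le_trans (mnorm_infD _ _) _; rewrite lerD//.
apply: le_trans (fl_expP flP _) _; rewrite ler_wpM2l ?mulr_ge0//.
rewrite -(subrK (expmx V) (expmx (Vhat k))) (le_trans (mnorm_infD _ _))//.
by rewrite -[leRHS](subrK 1) lerD.
Qed.

(** The inherited error is a mean of the errors of [What] with weights of modulus 1, so it costs
    neither [m] nor [n]. The FFT error is relative to the norm of [n y + F dw], at most
    [n (sqrt n maxY + d)]: after division by [n] this leaves the [sqrt n] in front of [maxY]. *)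
Lemma Rhat_err (d : R) k : 0 <= d ->
  (forall j, mnorm_inf (What j - expmx (blkpoly U (node j))) <= d) ->
  mnorm_inf (Rhat k - theta ^+ k *: Y k) <=
  d + m%:R * (g * (Num.sqrt N%:R * maxY + d)).
Proof.
move=> d0 Wd; pose W j := expmx (blkpoly U (node j)).
have N0 : (N%:R : R[i]) != 0 by rewrite pnatr_eq0.
pose wh r s := \col_j What j r s; pose y r s := \col_j (theta ^+ j *: Y j) r s.
pose dw r s : 'cV[R[i]]_N := \col_j (What j - W j) r s.
have whE r s : wh r s = fourierH R N *m y r s + dw r s.
  apply/matrixP => j o; rewrite ord1 [RHS]mxE fft_col YU !mxE.
  by rewrite addrC subrK.
(* [E1] is the error of the exponentials carried through the exact inverse transform, [E2] the error
   of the FFT itself. *)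
pose E1 : 'M[R[i]]_m := N%:R^-1 *: \sum_(j < N) w ^+ (k * j) *: (What j - W j).
pose E2 : 'M[R[i]]_m := \matrix_(r, s)
  (N%:R^-1 * (fourier R N *m wh r s - fl_F fl (wh r s)) k 0).
have -> : Rhat k - theta ^+ k *: Y k = E1 - E2.
  apply/matrixP => r s; rewrite !mxE.
  have -> : \sum_j fourier R N k j * wh r s j 0 = N%:R * y r s k 0 +
      \sum_(j < N) w ^+ (k * j) * (What j - W j) r s.
    transitivity ((fourier R N *m wh r s) k 0); first by rewrite mxE.
    rewrite whE mulmxDr mulmxA fourierK mul_scalar_mx mxE; congr (_ + _).
      by rewrite mxE.
    by rewrite mxE; apply: eq_bigr => j _; rewrite !mxE.
  rewrite summxE !mxE -/(wh r s).
  under [X in _ = _ * X - _]eq_bigr do rewrite mxE.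
  by field.
apply: le_trans (mnorm_infB _ _) _; apply: lerD.
  apply: le_trans (mnorm_infZ _ _) _; rewrite normc_natV mulrC ler_pdivrMr//.
  apply: le_trans (mnorm_inf_sum _ _ _) _.
  apply: (@le_trans _ _ (\sum_(j < N) d));
    last by rewrite sumr_const card_ord mulr_natr.
  apply: ler_sum => j _; apply: le_trans (mnorm_infZ _ _) _.
  by rewrite normcX normc_omega expr1n mul1r.
have b0 : 0 <= Num.sqrt N%:R * maxY + d by rewrite addr_ge0// mulr_ge0
  ?sqrtr_ge0.
apply: mnorm_inf_le_max; first by rewrite mulr_ge0.
move=> r s; rewrite mxE Normc.normcM normc_natV mulrC ler_pdivrMr//.
apply: le_trans (entry_le_vnorm2 _ _) _; apply: le_trans (fl_FP flP _) _.
rewrite -[leRHS]mulrA ler_wpM2l// whE mulmxDr mulmxA fourierK mul_scalar_mx.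
apply: le_trans (vnorm2D _ _) _; rewrite mulrDl; apply: lerD.
  rewrite -mulrA [maxY * _]mulrC vnorm2_le_max//; first by rewrite mulr_ge0.
  move=> j; rewrite !mxE Normc.normcM -(rmorph_nat (real_complex R)) normc_real.
  rewrite normr_nat ler_wpM2l// Normc.normcM normcX -[leRHS]mul1r.
  rewrite ler_pM ?exprn_ge0 ?normc_ge0// ?exprn_ile1 ?normc_ge0//.
  exact: le_trans (entry_le_mnorm_inf _ _ _) (maxYP j).
rewrite vnorm2_fourier (_ : d * N%:R = Num.sqrt N%:R * (Num.sqrt N%:R * d)).
  rewrite ler_wpM2l ?sqrtr_ge0// vnorm2_le_max// => j; rewrite mxE.
  exact: le_trans (entry_le_mnorm_inf _ _ _) (Wd j).
by rewrite mulrA -expr2 sqr_sqrtr// mulrC.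
Qed.

(** Besides the amplified error [d] there is the rounding of the last product, relative to the
    computed [Rhat k], whose norm is at most [d + maxY]. *)
Lemma algorithmA_err (d : R) (k : 'I_N) :
  mnorm_inf (Rhat k - theta ^+ k *: Y k) <= d ->
  mnorm_inf (Y k - algorithmA fl U k) <=
  (nc theta ^+ N)^-1 * ((1 + z) * d + z * maxY).
Proof.
move=> Rd.
have tk0 : theta ^+ k != 0 by rewrite expf_neq0.
have nct0 : 0 < nc theta by rewrite lt_neqAle eq_sym normc_eq0 theta_neq0
  normc_ge0.
have tkN : nc (theta ^+ k)^-1 <= (nc theta ^+ N)^-1.
  rewrite Normc.normcV normcX lef_pV2 ?posrE ?exprn_gt0//.
  by rewrite ler_wiXn2l ?normc_ge0// ltnW.
have d0 : 0 <= d by exact: le_trans (mnorm_inf_ge0 _) Rd.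
have Rle : mnorm_inf (Rhat k) <= d + maxY.
  rewrite -(subrK (theta ^+ k *: Y k) (Rhat k)) (le_trans (mnorm_infD _ _))//
    lerD//.
  rewrite (le_trans (mnorm_infZ _ _))// -[leRHS]mul1r ler_pM ?normc_ge0
    ?mnorm_inf_ge0//.
  by rewrite normcX exprn_ile1 ?normc_ge0.
pose E : 'M[R[i]]_m := \matrix_(r, s)
  (fl_mul fl (fl_theta fl (- k%:Z)) (Rhat k r s) - (theta ^+ k)^-1 * Rhat k r
    s).
have -> : Y k - algorithmA fl U k =
    - ((theta ^+ k)^-1 *: (Rhat k - theta ^+ k *: Y k)) - E.
  rewrite scalerBr scalerA mulVf// scale1r opprB algorithmAE.
  by apply/matrixP => r s; rewrite !mxE opprB addrA subrK.
apply: le_trans (mnorm_infB _ _) _; rewrite mnorm_infN.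
have -> : (nc theta ^+ N)^-1 * ((1 + z) * d + z * maxY) =
  (nc theta ^+ N)^-1 * d + z * ((nc theta ^+ N)^-1 * (d + maxY)) by ring.
apply: lerD.
  by apply: le_trans (mnorm_infZ _ _) _;
    rewrite ler_pM ?normc_ge0 ?mnorm_inf_ge0.
apply: mnorm_inf_le.
  by rewrite mulr_ge0// mulr_ge0 ?addr_ge0// invr_ge0 exprn_ge0// normc_ge0.
move=> r; apply: (@le_trans _ _ (\sum_s z * (nc (theta ^+ k)^-1 * nc (Rhat k r
  s)))).
  apply: ler_sum => s _; rewrite mxE -Normc.normcM exprnN fl_scale//.
  by rewrite abszN absz_nat.
rewrite -mulr_sumr -mulr_sumr ler_wpM2l// ler_pM ?normc_ge0//.
  by rewrite sumr_ge0// => *; exact: normc_ge0.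
exact: le_trans (row_le_mnorm_inf _ _) Rle.
Qed.

End ErrorBound.

(** * First-order expansion of the accumulated bound *)

Section TotalError.
Variables (R : realType) (q n m : nat) (tau maxU maxY : R).
Hypotheses (tau_ge0 : 0 <= tau) (maxU_ge0 : 0 <= maxU) (maxY_ge0 : 0 <= maxY).

(** This and the next three definitions chain the bounds of the successive steps as functions of
    [mu] in which no arithmetic [fl] occurs. *)
Definition node_err (mu : R) : R := m%:R * (n%:R * maxU *
  (fft_bound q mu * (1 + mul_err mu) + mul_err mu)).

Definition exp_err (mu : R) : R :=
  mu * tau * expR (node_err mu) + (expR (node_err mu) - 1).

Definition ifft_err (mu : R) : R := exp_err mu +
  m%:R * (fft_bound q mu * (Num.sqrt n%:R * maxY + exp_err mu)).

Definition block_err (mu : R) : R :=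
  (1 + mul_err mu) * ifft_err mu + mul_err mu * maxY.

Local Notation zeta := (1 + 2 * Num.sqrt 2 : R).
Local Notation gamma := (4 * Num.sqrt 2 + 1 : R).

Lemma first_order_node_err :
  first_order node_err (m%:R * (n%:R * maxU * (q%:R * gamma + zeta))).
Proof.
apply: first_orderZ => //; apply: first_orderZ; first exact: mulr_ge0.
have z := first_order_mul_err R; have g := first_order_fft_bound R q.
have -> : (fun mu : R => fft_bound q mu * (1 + mul_err mu) + mul_err mu) =
    (fun mu => fft_bound q mu + fft_bound q mu * mul_err mu + mul_err mu).
  by apply/funext => mu; rewrite mulrDr mulr1.
rewrite -[q%:R * _]addr0; do 2 apply: first_orderD => //.
exact: first_orderM g z.
Qed.

Lemma first_order_exp_err : first_order exp_err
  (tau + m%:R * (n%:R * maxU * (q%:R * gamma + zeta))).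
Proof.
have e := first_order_expR first_order_node_err.
(* Isolating [tau * mu] leaves a product of two small quantities, which is quadratic. *)
have -> : exp_err = (fun mu => tau * mu +
    tau * (mu * (expR (node_err mu) - 1)) + (expR (node_err mu) - 1)).
  by apply/funext => mu; rewrite /exp_err; ring.
apply: first_orderD => //; rewrite [X in first_order _ X](_ : tau = tau * 1 +
  tau * 0); last by rewrite mulr1 mulr0 addr0.
apply: first_orderD; apply: first_orderZ => //; first exact: first_order_id.
exact: first_orderM (first_order_id R) e.
Qed.

Lemma first_order_ifft_err : first_order ifft_err
  (tau + m%:R * (n%:R * maxU * (q%:R * gamma + zeta)) +
   m%:R * Num.sqrt n%:R * maxY * (q%:R * gamma)).
Proof.
have e := first_order_exp_err; have g := first_order_fft_bound R q.
have -> : ifft_err = (fun mu => exp_err mu +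
    (m%:R * Num.sqrt n%:R * maxY * fft_bound q mu +
     m%:R * (fft_bound q mu * exp_err mu))).
  by apply/funext => mu; rewrite /ifft_err; ring.
apply: first_orderD => //; rewrite -[X in first_order _ X]addr0 -[X in
  first_order _ (_ + X)](mulr0 m%:R).
apply: first_orderD; apply: first_orderZ => //.
  by rewrite !mulr_ge0 ?sqrtr_ge0.
exact: first_orderM g e.
Qed.

Lemma first_order_block_err : first_order block_err
  (tau + m%:R * (n%:R * maxU * (q%:R * gamma + zeta)) +
   m%:R * Num.sqrt n%:R * maxY * (q%:R * gamma) + maxY * zeta).
Proof.
have e := first_order_ifft_err; have z := first_order_mul_err R.
have -> : block_err = (fun mu => ifft_err mu + mul_err mu * ifft_err mu +
    maxY * mul_err mu).
  by apply/funext => mu; rewrite /block_err; ring.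
apply: first_orderD; last exact: first_orderZ.
rewrite -[X in first_order _ X]addr0; apply: first_orderD => //.
exact: first_orderM z e.
Qed.

End TotalError.

Theorem theorem6 (R : realType) (q n m : nat) (U : 'I_n -> 'M[R]_m)
  (eps theta : R[i]) (Y : 'I_n -> 'M[R[i]]_m) (tau : R)
  (hn : n = (2 ^ q)%N)
  (hU : subgenerator (block_toeplitz U))
  (heps : 0 < Normc.normc eps < 1)
  (htheta : theta ^+ n = eps)
  (hY : block_circulant eps Y =
        expmx (block_circulant eps (fun h => map_mx (real_complex R) (U h)))) :
  let zeta : R := 1 + 2 * Num.sqrt 2 in
  let gamma : R := 4 * Num.sqrt 2 + 1 in
  let maxU : R :=
    \big[Num.max/0]_(h < n) \big[Num.max/0]_(r < m) \big[Num.max/0]_(s < m)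
      `|U h r s| in
  let maxY : R := \big[Num.max/0]_(h < n) mnorm_inf (Y h) in
  let phi : R :=
    m%:R * n%:R * (zeta + gamma * log2 n%:R) * maxU
    + (zeta + gamma * Num.sqrt n%:R * log2 n%:R) * maxY
    + tau in
  exists C : R, \forall mu \near 0^'+,
    forall fl : fl_arith R n m, fl_model q theta tau mu fl ->
    forall k : 'I_n,
      mnorm_inf
        (Y k - algorithmA fl (fun h => map_mx (real_complex R) (U h)) k)
      <= mu * (Normc.normc eps)^-1 * m%:R * phi + C * mu ^+ 2.
Proof.
case: n U Y hn hU htheta hY => [|n'] U Y hn hU htheta hY.
  by have := expn_gt0 2 q; rewrite -hn.
move=> zeta gamma maxU maxY phi.
(* The comparison of coefficients below needs [m >= 1]; for [m = 0] every norm vanishes. *)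
have [m0|m_gt0] := posnP m.
  subst m; exists 0; near=> mu => fl _ k.
  by rewrite mulr0 !mul0r addr0 mnorm_inf_le// => -[].
(* For negative [tau] no arithmetic satisfies the model: at [V = 0] the exponential is the identity,
   of positive norm, and an error norm would be negative. *)
have [tau_lt0|tau_ge0] := ltP tau 0.
  exists 0; near=> mu => fl flP k; exfalso.
  have mu_gt0 : 0 < mu by near: mu; exact: nbhs_right_gt.
  have := fl_expP flP 0; rewrite leNgt => /negP; apply.
  have mt : mu * tau < 0 by rewrite pmulr_rlt0.
  apply: lt_le_trans (mnorm_inf_ge0 _); rewrite nmulr_rlt0// expmx0.
  apply: (lt_le_trans ltr01).
  have := entry_le_mnorm_inf (1%:M : 'M[R[i]]_m) (Ordinal m_gt0) (Ordinal
    m_gt0).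
  by rewrite mxE eqxx Normc.normc1.
have maxU_ge0 : 0 <= maxU by exact: bigmax_ge_id.
have maxY_ge0 : 0 <= maxY by exact: bigmax_ge_id.
have maxUP h r s : nc (map_mx (real_complex R) (U h) r s) <= maxU.
  rewrite mxE normc_real.
  apply: le_trans (le_bigmax _ (fun h => \big[Num.max/0]_r \big[Num.max/0]_s
    `|U h r s|) h).
  apply: le_trans (le_bigmax _ (fun r => \big[Num.max/0]_s `|U h r s|) r).
  exact: le_bigmax _ (fun s => `|U h r s|) s.
have maxYP h : mnorm_inf (Y h) <= maxY by exact: (le_bigmax _ (fun h =>
  mnorm_inf (Y h))).
have coef_le :
    (nc eps)^-1 * (tau + m%:R * (n'.+1%:R * maxU * (q%:R * gamma + zeta)) +
      m%:R * Num.sqrt n'.+1%:R * maxY * (q%:R * gamma) + maxY * zeta) <=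
    (nc eps)^-1 * m%:R * phi.
  rewrite -[leRHS]mulrA ler_wpM2l ?invr_ge0 ?normc_ge0//.
  rewrite /phi (_ : log2 n'.+1%:R = q%:R); last by rewrite hn log2_exp2.
  have m1 : 0 <= m%:R - 1 :> R by rewrite subr_ge0 ler1n.
  rewrite -subr_ge0.
  (* The [gamma sqrt n] terms cancel; what remains of [m phi] minus the coefficient obtained is a
     multiple of [m - 1]. Abstracting the square root as [s] makes it an identity of polynomials. *)
  have -> : forall s : R, m%:R * (m%:R * n'.+1%:R * (zeta + gamma * q%:R) *
    maxU +
      (zeta + gamma * s * q%:R) * maxY + tau) -
      (tau + m%:R * (n'.+1%:R * maxU * (q%:R * gamma + zeta)) +
       m%:R * s * maxY * (q%:R * gamma) + maxY * zeta) =
      (m%:R - 1) * (m%:R * (n'.+1%:R * maxU * (q%:R * gamma + zeta)) + zeta *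
        maxY + tau).
    by move=> s; ring.
  have zeta_ge0 : 0 <= zeta by rewrite addr_ge0// mulr_ge0// sqrtr_ge0.
  have gamma_ge0 : 0 <= gamma by rewrite addr_ge0// mulr_ge0// sqrtr_ge0.
  by rewrite mulr_ge0// !addr_ge0// !mulr_ge0// addr_ge0// mulr_ge0.
have eps_inv : 0 <= (nc eps)^-1 by rewrite invr_ge0 normc_ge0.
have [C hC] := first_order_weaken coef_le (first_orderZ eps_inv
  (first_order_block_err q n'.+1 m tau_ge0 maxU_ge0 maxY_ge0)).
exists C; near=> mu => fl flP k.
have /andP[_ errC] : 0 <= (nc eps)^-1 * block_err q n'.+1 m tau maxU maxY mu <=
  (nc eps)^-1 * m%:R * phi * mu + C * mu ^+ 2 by near: mu.
have mu_gt0 : 0 < mu by near: mu; exact: nbhs_right_gt.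
(* The sign holds only for small [mu], because of denominators such as [1 - 2 * mu]. *)
have /andP[z_ge0 _] : 0 <= mul_err mu < 1.
  by near: mu; exact: first_order_lt ltr01 (first_order_mul_err R).
have /andP[g_ge0 _] : 0 <= fft_bound q mu < 1.
  by near: mu; exact: first_order_lt ltr01 (first_order_fft_bound R q).
have -> : mu * (nc eps)^-1 * m%:R * phi = (nc eps)^-1 * m%:R * phi * mu by ring.
apply: le_trans errC.
have nc_theta : nc theta ^+ n'.+1 = nc eps by rewrite -normcX htheta.
have theta_neq0 : theta != 0.
  apply/eqP => theta0; move: heps.
  by rewrite -nc_theta theta0 Normc.normc0 expr0n ltxx.
have theta_le1 : nc theta <= 1.
  rewrite leNgt; apply/negP => theta1; have /andP[_] := heps.
  by rewrite ltNge -nc_theta exprn_ege1// ltW.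
(* The nodes are [n]-th roots of [eps], so the hypothesis on [Y] can be read at each of them. *)
have nodeX j : (theta * (omega R n'.+1)^-1 ^+ j) ^+ n'.+1 = eps.
  rewrite exprMn htheta exprAC exprVn (prim_expr_order (omega_prim R (ltn0Sn
    n'))).
  by rewrite invr1 expr1n mulr1.
have YU j : blkpoly Y (theta * (omega R n'.+1)^-1 ^+ j) =
    expmx (blkpoly (fun h => map_mx (real_complex R) (U h))
                   (theta * (omega R n'.+1)^-1 ^+ j)).
  by apply: expmx_circulant; rewrite nodeX.
have [c Uc] := subgenerator_blkpoly hU.
have mu_ge0 := ltW mu_gt0.
rewrite -nc_theta.
apply: (algorithmA_err flP theta_neq0 theta_le1) => //.
have Vle := Vhat_err flP theta_le1 z_ge0 g_ge0 maxUP maxU_ge0.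
have Wle j := What_err flP theta_le1 mu_ge0 tau_ge0 Uc (Vle j).
have exp_ge0 := le_trans (mnorm_inf_ge0 _) (Wle ord0).
exact: (Rhat_err flP theta_le1 g_ge0 maxYP YU k exp_ge0 Wle).
Unshelve. all: by end_near.
Qed.
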